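(* (a) Let $d_0\ge2$ be an integer, $0<\delta<\frac12$, $\varepsilon>0$. Let $\mathcal{G}_{\mathrm{ext}}(d_0,\delta)$ be the class of finite connected graphs $G$ with $|G|\ge2$ and $\deg(G)\le d_0$ such that either $\lambda_G\le|G|^{-2(1-\delta)}(\log|G|)^{-1}$ or $\lambda_G\ge|G|^{-\delta/10}$. Then $$\lim_{|G|\to\infty,\ G\in\mathcal{G}_{\mathrm{ext}}(d_0,\delta)}\ \inf_{x\in E}P_x\big[|G|^{2(1-\delta)}\le\mathcal{T}_G\le|G|^2(\log|G|)^{4+\varepsilon}\big]=1 .$$ (b) Consequently, if $G_N$, $N\ge1$, is a sequence of finite connected graphs with $\deg(G_N)\le d_0$, $|G_N|\to\infty$, and either $\lambda_{G_N}=|G_N|^{o(1)}$ or $\lambda_{G_N}=|G_N|^{-2+o(1)}$ as $N\to\infty$, then for all $\delta,\varepsilon>0$, with $E_N=G_N\times\mathbb{Z}$, $$\lim_{N\to\infty}\inf_{x\in E_N}P_x\big[|G_N|^{2(1-\delta)}\le\mathcal{T}_{G_N}\le|G_N|^2(\log|G_N|)^{4+\varepsilon}\big]=1.$$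
   Context: Graphs are simple and undirected and identified with their vertex sets; $|G|$ is the number of vertices, $\deg(G)$ the maximal number of neighbors of a vertex, $g\sim g'$ means neighbors. The cylinder $E=G\times\mathbb{Z}$ has the product graph structure ($(g,u)\sim(g',u')$ iff $g=g'$, $|u-u'|=1$ or $u=u'$, $g\sim g'$). $P_x$, $x\in E$, is the law of the discrete-time simple random walk $(X_n)_{n\ge0}$ on $E$ from $x$ (uniform jumps to neighbors). A finite $S\subseteq E$ disconnects $E$ if for large $M$, $G\times[M,\infty)$ and $G\times(-\infty,-M]$ lie in two distinct connected components of $E\setminus S$; $\mathcal{T}_G=\inf\{n\ge0:\{X_0,\dots,X_n\}\text{ disconnects }E\}$. The spectral gap is $\lambda_G=\inf_f\mathcal{D}_G(f,f)/\mathrm{var}(f)$ over nonconstant $f:G\to\mathbb{R}$, where $\mathcal{D}_G(f,f)=\frac1{2|G|}\sum_{g,g'\in G,\,g\sim g'}(f(g')-f(g))^2$ and $\mathrm{var}$ is the variance under the uniform distribution on $G$. Limits over a class of graphs as $|G|\to\infty$ are uniform over the class. *)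

(* Defs.v *)
From HB Require Import structures.
From mathcomp Require Import all_boot all_order all_algebra.
From mathcomp Require Import zify ring lra.
From mathcomp Require Import all_classical all_reals all_analysis.
Set Implicit Arguments.
Unset Strict Implicit.
Unset Printing Implicit Defensive.
Import Order.TTheory GRing.Theory Num.Theory.
Import numFieldNormedType.Exports.
Local Open Scope classical_set_scope.
Local Open Scope ring_scope.

Record sgraph := SGraph {
  vertex :> finType;
  adj : rel vertex;
  adj_sym : symmetric adj;
  adj_irr : irreflexive adj;
  vertex_gt0 : (0 < #|vertex|)%N }.

Section FiniteGraph.
Variable G : sgraph.

Definition connected_graph : Prop := forall g g' : G, connect (@adj G) g g'.

Definition maxdeg : nat := \max_(g : G) #|[set g' | adj g g']%SET|.

Variable R : realType.
Implicit Type f : G -> R.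

Definition dirichlet f : R :=
  (2 * #|G|%:R)^-1 * \sum_(g : G) \sum_(g' : G | adj g g') (f g' - f g) ^+ 2.

Definition mean f : R := #|G|%:R^-1 * \sum_(g : G) f g.

Definition variance_unif f : R :=
  #|G|%:R^-1 * \sum_(g : G) (f g - mean f) ^+ 2.

(* A real infimum: for #|G| = 1 the set is empty and the value is 0. *)
Definition spectral_gap : R :=
  inf [set dirichlet f / variance_unif f
      | f in [set f | exists g g', f g <> f g']].

End FiniteGraph.

(* F(G) tends to l as #|G| tends to infinity, uniformly over the class C.
   A predicate instead of a set: sgraph is too large for the universe of set. *)
Definition cvg_large (C : sgraph -> Prop) (T : topologicalType)
    (F : sgraph -> T) (l : T) : Prop :=
  forall A, nbhs l A ->
    exists n, forall G : sgraph, C G -> (n <= #|G|)%N -> A (F G).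

Definition cylinder (G : sgraph) : Type := (G * int)%type.

HB.instance Definition _ G := Countable.on (cylinder G).

Fact cylinder_inhabited (G : sgraph) : exists g : G, true.
Proof. by have /card_gt0P[g _] := vertex_gt0 G; exists g. Qed.

(* Measurable types are pointed in the library; the point is irrelevant. *)
HB.instance Definition _ G :=
  isPointed.Build (cylinder G) (xchoose (cylinder_inhabited G), 0).

Section Cylinder.
Variable G : sgraph.
Local Notation E := (cylinder G).

Definition adjE : rel E := fun y z =>
  (y.1 == z.1) && (`|y.2 - z.2| == 1) || (y.2 == z.2) && adj y.1 z.1.

Definition nbrs (y : E) : seq E :=
  (y.1, y.2 + 1) :: (y.1, y.2 - 1) ::
    [seq (g, y.2) | g <- enum [set g' | adj y.1 g']%SET].

Arguments nbrs : simpl never.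

Lemma mem_nbrs y z : (z \in nbrs y) = adjE y z.
Proof.
case: y z => [g u] [h v]; rewrite /adjE /nbrs /= !inE orbA; congr orb.
  rewrite !xpair_eqE /= -andb_orr (eq_sym h); congr andb.
  by apply/idP/idP; lia.
apply/mapP/andP => [[k]|[/eqP-> gh]]; first by rewrite mem_enum inE => gk [-> ->].
by exists h; rewrite ?mem_enum ?inE.
Qed.

Lemma nbrs_uniq y : uniq (nbrs y).
Proof.
case: y => g u; rewrite /nbrs /= !inE negb_or map_inj_uniq ?enum_uniq; last first.
  by move=> ? ? [].
rewrite andbT -andbA; apply/and3P; split.
- by rewrite xpair_eqE eqxx /=; lia.
- by apply/mapP => -[k _ [_]]; lia.
- by apply/mapP => -[k _ [_]]; lia.
Qed.

Definition connected_off (S : set E) (y z : E) : Prop :=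
  exists p : seq E,
    [/\ path adjE y p, last y p = z & forall w, w \in y :: p -> ~ S w].

Definition components (S : set E) : set (set E) :=
  [set [set z | connected_off S y z] | y in ~` S].

Definition disconnects (S : set E) : Prop :=
  finite_set S /\
  \forall M \near \oo, exists C1 C2 : set E,
    [/\ components S C1, components S C2, C1 <> C2,
        (forall g u, M%:Z <= u -> C1 (g, u)) &
        (forall g u, u <= - M%:Z -> C2 (g, u))].

Definition path_cylinder (n : nat) (e : nat -> E) : set (nat -> E) :=
  [set X | forall i, (i <= n)%N -> X i = e i].

Definition path_cylinders : set (set (nat -> E)) :=
  [set A | exists n e, A = path_cylinder n e].

(* E is countable: this is the sigma-algebra generated by the coordinates. *)
Definition trajectory := g_sigma_algebraType path_cylinders.

HB.instance Definition _ := Measurable.on trajectory.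

(* The infimum of the empty set is +oo. *)
Definition disconnection_time (R : realType) (X : nat -> E) : \bar R :=
  ereal_inf [set n%:R%:E | n in [set n | disconnects (X @` `I_n.+1)]].

Variable R : realType.

Definition step_prob (y z : E) : R :=
  if adjE y z then (size (nbrs y))%:R^-1 else 0.

Definition path_prob (x : E) (n : nat) (e : nat -> E) : R :=
  (e 0%N == x)%:R * \prod_(i < n) step_prob (e i) (e i.+1).

Definition is_srw_law (x : E) (P : probability trajectory R) : Prop :=
  forall (n : nat) (e : nat -> E),
    P [set X | forall i, (i <= n)%N -> X i = e i] = (path_prob x n e)%:E.

Lemma path_cylinder_measurable n e :
  measurable (path_cylinder n e : set trajectory).
Proof. by apply: sub_sigma_algebra; exists n, e. Qed.

(* Auxiliary to srw_law_exists: the walk is driven by a single uniform variable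
   s.2 on [0, 1[, whose leading digit in base (size (nbrs s.1)) chooses the jump and whose
   remaining digits drive the rest of the trajectory. *)
Let drive (s : E * R) : E * R :=
  let k := (size (nbrs s.1))%:R in
  let j := Num.truncn (k * s.2) in
  (nth s.1 (nbrs s.1) j, k * s.2 - j%:R).

Let walk (x : E) (u : R) : nat -> E := fun n => (iter n drive (x, u)).1.

Let path_prob_ge0 x n e : 0 <= path_prob x n e.
Proof.
rewrite mulr_ge0 ?ler0n// prodr_ge0// => i _.
by rewrite /step_prob; case: ifP => // _; rewrite invr_ge0 ler0n.
Qed.

Let walkS x u n :
  walk x u n.+1 = walk (drive (x, u)).1 (drive (x, u)).2 n.
Proof. by rewrite /walk iterSr -surjective_pairing. Qed.

Let path_probS x n e :
  path_prob x n.+1 e =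
  (e 0%N == x)%:R * step_prob x (e 1%N) * path_prob (e 1%N) n (e \o S).
Proof.
rewrite /path_prob big_ord_recl/= eqxx mul1r !mulrA.
by case: eqP => [->|]//; rewrite !mul0r.
Qed.

Let walk_itv n x e : exists a : R,
  [/\ 0 <= a, a + path_prob x n e <= 1 & forall u, 0 <= u < 1 ->
      path_cylinder n e (walk x u) <-> a <= u < a + path_prob x n e].
Proof.
elim: n x e => [|n IH] x e.
  exists 0; rewrite /path_prob big_ord0 mulr1 add0r; split => //.
    by case: eqP.
  move=> u u01; case: eqP => ex; split.
  - by [].
  - by move=> _ [_|//]; rewrite ex.
  - by move=> h; case: ex; have /esym := h 0%N isT.
  - by move=> /andP[u0 /(le_lt_trans u0)]; rewrite ltxx.
have [a [a0 a1 aP]] := IH (e 1%N) (e \o S).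
have w0 := path_prob_ge0 (e 1%N) n (e \o S).
have := path_probS x n e; set W := path_prob x n.+1 e.
move: a1 aP w0; set w := path_prob (e 1%N) n (e \o S) => a1 aP w0 WE.
pose k : R := (size (nbrs x))%:R.
have k0 : 0 < k by rewrite ltr0n.
have nthP u : 0 <= u < 1 ->
    [/\ (Num.truncn (k * u) < size (nbrs x))%N,
        0 <= k * u - (Num.truncn (k * u))%:R &
        k * u - (Num.truncn (k * u))%:R < 1].
  move=> /andP[u0 u1]; have ku0 : 0 <= k * u by rewrite mulr_ge0// ltW.
  have /andP[t1 t2] := truncn_itv ku0; split.
  - by rewrite truncn_lt_nat// -/k -[ltRHS]mulr1 ltr_pM2l.
  - by rewrite subr_ge0.
  - by rewrite ltrBlDl natr1.
have [exE|] := pselect (e 0%N = x /\ adjE x (e 1%N)); last first.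
  move=> nex; have {WE}W0 : W = 0.
    rewrite WE /step_prob; case: eqP => [ex|_]; last by rewrite !mul0r.
    by case: ifP => [ax|_]; [exfalso; exact: nex|rewrite mulr0 mul0r].
  exists 0; rewrite W0 addr0; split => // u u01; split; last first.
    by move=> /andP[u0 /(le_lt_trans u0)]; rewrite ltxx.
  move=> h; exfalso; apply: nex; split; first by have /esym := h 0%N isT.
  have /= <- := h 1%N isT; rewrite -mem_nbrs /walk /=.
  by have [t1 _ _] := nthP _ u01; rewrite mem_nth.
case: exE => ex ax; pose j0 := index (e 1%N) (nbrs x).
have {WE}WE : W = w / k by rewrite WE ex eqxx mul1r /step_prob ax mulrC.
have j0k : (j0 < size (nbrs x))%N by rewrite index_mem mem_nbrs.
have j0k' : j0%:R + 1 <= k :> R by rewrite natr1 ler_nat.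
exists ((j0%:R + a) / k); rewrite WE -mulrDl; split.
- by rewrite divr_ge0 ?addr_ge0// ltW.
- by rewrite ler_pdivrMr// mul1r -addrA (le_trans _ j0k')// lerD2l.
move=> u u01; rewrite ler_pdivrMr// ltr_pdivlMr//.
have [t1 t2 t3] := nthP _ u01.
pose u' := k * u - (Num.truncn (k * u))%:R.
have u'01 : 0 <= u' < 1 by rewrite t2 t3.
split=> [h|h].
- have /= h1 := h 1%N isT.
  have tj : Num.truncn (k * u) = j0.
    rewrite /j0 -h1 -[walk x u 1]/(nth x (nbrs x) (Num.truncn (k * u))).
    by rewrite index_uniq// nbrs_uniq.
  have h' : path_cylinder n (e \o S) (walk (e 1%N) u').
    by move=> i ni /=; rewrite -(h i.+1 ni) walkS -h1.
  have := (aP _ u'01).1 h'; rewrite /u' tj => /andP[b1 b2].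
  by apply/andP; split; lra.
- have ku0 : 0 <= k * u by rewrite mulr_ge0 ?(ltW k0)//; case/andP: u01.
  case/andP: h => b1 b2.
  have tj : Num.truncn (k * u) = j0.
    by apply: truncn_def; rewrite -natr1; apply/andP; split; lra.
  have := (aP _ u'01).2; rewrite /u' tj => /(_ _)h'.
  have {}h' : path_cylinder n (e \o S) (walk (e 1%N) (k * u - j0%:R)).
    by apply: h'; apply/andP; split; lra.
  case=> [_|i ni]; first by rewrite ex.
  rewrite walkS -[drive _]/(nth x (nbrs x) (Num.truncn (k * u)), u') /u' tj.
  by rewrite nth_index ?mem_nbrs// (h' i ni).
Qed.

Let walk01 (x : E) (u : measurableTypeR R) : trajectory :=
  walk x (if 0 <= u < 1 then u else 0).

Let walk01_preimage x n e : exists a : R,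
  [/\ 0 <= a, a + path_prob x n e <= 1 &
      [set u | 0 <= u < 1] `&` (walk01 x : R -> trajectory) @^-1` path_cylinder n e =
      `[a, a + path_prob x n e[%classic].
Proof.
have [a [a0 a1 aP]] := walk_itv n x e; exists a; split => //.
apply/seteqP; split => u /=; rewrite in_itv/= /walk01.
  by case=> u01; rewrite u01 => /(aP _ u01).
move=> au; have u01 : 0 <= u < 1.
  by case/andP: au => b1 b2; apply/andP; split; lra.
by rewrite u01; split => //; exact/aP.
Qed.

Let walk01_measurable x :
  measurable_fun [set: measurableTypeR R] (walk01 x).
Proof.
apply: (@measurability _ _ (measurableTypeR R) trajectory setT (walk01 x)
  path_cylinders erefl).
move=> _ [_ [n [e ->]] <-]; rewrite setTI.
pose I : set (measurableTypeR R) := `[0, 1[%classic.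
have IE : I = [set u : R | 0 <= u < 1].
  by apply/seteqP; split=> u /=; rewrite /I/= in_itv.
have mI : measurable I by exact: measurable_itv.
have [a [_ _ aE]] := walk01_preimage x n e; rewrite -IE in aE.
rewrite -(setUIDK (walk01 x @^-1` path_cylinder n e) I) setIC aE.
apply: measurableU; first exact: measurable_itv.
have [h|h] := pselect (path_cylinder n e (walk x 0)).
  suff -> : walk01 x @^-1` path_cylinder n e `\` I = ~` I.
    exact: measurableC.
  apply/seteqP; split=> u /=; first by case.
  by rewrite IE /= /walk01 => /negP/negbTE ->.
suff -> : walk01 x @^-1` path_cylinder n e `\` I = set0 by [].
apply/seteqP; split=> u //= -[].
by rewrite IE /= /walk01 => + /negP/negbTE u01; rewrite u01.
Qed.

Let uniform_itv (a b : R) : 0 <= a -> a <= b -> b <= 1 ->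
  uniform_prob (@ltr01 R) `[a, b[%classic = (b - a)%:E.
Proof.
move=> a0 ab b1; rewrite /uniform_prob integral_uniform_pdf setIidl; last first.
  by move=> u /=; rewrite !in_itv/= => /andP[? ?]; apply/andP; split; lra.
rewrite (eq_integral (cst 1%E)) ?integral_cst//= ?mul1e.
  rewrite lebesgue_measure_itv/= lte_fin; case: ltP => //= ba.
  by have -> : a = b; [apply/le_anti; rewrite ab|rewrite subrr].
move=> u; rewrite inE/= in_itv/= => /andP[? ?]; rewrite /uniform_pdf.
by rewrite subr0 invr1 ifT//; apply/andP; split; lra.
Qed.

Lemma srw_law_exists (x : E) :
  exists P : probability trajectory R, is_srw_law x P.
Proof.
pose w : {mfun measurableTypeR R >-> trajectory} :=
  mfun_Sub (mem_set (walk01_measurable x)).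
exists (distribution (uniform_prob (@ltr01 R)) w) => n e.
have [a [a0 a1 aE]] := walk01_preimage x n e.
pose I : set (measurableTypeR R) := `[0, 1[%classic.
have IE : I = [set u : R | 0 <= u < 1].
  by apply/seteqP; split=> u /=; rewrite /I/= in_itv.
rewrite -IE in aE; have mI : measurable I by exact: measurable_itv.
have mA : measurable (w @^-1` path_cylinder n e).
  rewrite -[X in measurable X]setTI; apply: measurable_funPT => //.
  exact: path_cylinder_measurable.
pose U : probability (measurableTypeR R) R := uniform_prob (@ltr01 R).
have UI : U I = 1%E by rewrite /U/= uniform_itv ?subr0.
set A := w @^-1` path_cylinder n e in mA *.
transitivity (U A) => //.
transitivity (U (A `\` I) + U (A `&` I))%E; first exact (measureDI U mA mI).
have -> : U (A `\` I) = 0%E.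
  apply/eqP; rewrite eq_le measure_ge0 andbT.
  have <- : U (~` I) = 0%E by rewrite probability_setC// UI subee.
  apply: le_measure; rewrite ?inE; [exact: measurableD|exact: measurableC|].
  by move=> u [].
rewrite add0e setIC aE /U/= uniform_itv ?lerDl// ?path_prob_ge0//.
by rewrite addrC addKr.
Qed.

Lemma srw_law_unique (x : E) (P Q : probability trajectory R) :
  is_srw_law x P -> is_srw_law x Q ->
  forall A : set trajectory, measurable A -> P A = Q A.
Proof.
move=> xP xQ A mA.
pose C : set (set trajectory) := path_cylinders `|` [set set0].
pose g k : set trajectory :=
  if unpickle k is Some e then path_cylinder 0 (fun=> e) else set0.
apply: (@g_sigma_algebra_measure_unique _ R trajectory C _ g _ _ P Q) => //.
- move=> B [[n [e ->]]|->]; last exact: measurable0.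
  exact: path_cylinder_measurable.
- move=> k; rewrite /g; case: unpickle => [e|]; last by right.
  by left; exists 0%N, (fun=> e).
- apply/seteqP; split=> // X _; exists (pickle (X 0%N)) => //.
  by rewrite /g pickleK => i; rewrite leqn0 => /eqP->.
- move=> B D CB CD.
  have [->|/set0P[X [BX DX]]] := eqVneq (B `&` D) set0; first by right.
  case: CB BX => [[n [e ->]] Xe|->//]; case: CD DX => [[m [f ->]] Xf|->//].
  left; exists (maxn n m), X; apply/seteqP; split=> Y /=.
    case=> Ye Yf i; rewrite leq_max => /orP[ni|mi].
      by rewrite Ye// Xe.
    by rewrite Yf// Xf.
  move=> YX; split=> i li.
    by rewrite YX ?Xe// leq_max li.
  by rewrite YX ?Xf// leq_max li orbT.
- move=> B [[n [e ->]]|->]; last by rewrite !measure0.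
  by rewrite [LHS]xP [RHS]xQ.
- by move=> k; apply: (le_lt_trans (probability_le1 P _)); rewrite ?ltry//;
    rewrite /g; case: unpickle => [e|]; [exact: path_cylinder_measurable|].
- by apply: sub_sigma_algebra2 mA => B; left.
Qed.

Definition srw_law (x : E) : probability trajectory R :=
  sval (cid (srw_law_exists x)).

Lemma srw_lawP (x : E) : is_srw_law x (srw_law x).
Proof. exact: (svalP (cid (srw_law_exists x))). Qed.

End Cylinder.

Arguments srw_law {G} R x.
Arguments disconnection_time {G R} X.
Arguments spectral_gap G R : clear implicits.

Definition inf_disconnection_prob (R : realType) (delta eps : R) (G : sgraph) :
    \bar R :=
  let n : R := #|G|%:R in
  ereal_inf [set srw_law R x
      [set X | ((n `^ (2 * (1 - delta)))%:E <= disconnection_time X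
                <= (n ^+ 2 * ln n `^ (4 + eps))%:E)%E]
    | x in [set: cylinder G]].

Definition G_ext (R : realType) (d0 : nat) (delta : R) (G : sgraph) : Prop :=
  [/\ connected_graph G, (2 <= #|G|)%N, (maxdeg G <= d0)%N &
      let n : R := #|G|%:R in
      spectral_gap G R <= n `^ (- (2 * (1 - delta))) * (ln n)^-1 \/
      n `^ (- (delta / 10)) <= spectral_gap G R].

(* Main.v *)
(* Covering the starting level disconnects the cylinder, and a point is visited between
   two passages at distance h ~ |G| log |G| with probability at least 1/2: the oscillation
   on a level of its equilibrium potential is controlled as on a two-dimensional grid,
   [(phi x - phi y)^2 <= C log |G| * energy], while the energy is at most [|G| / h]. Hence
   log |G| such rounds cover the level, and they take time of order (h log |G|)^2.
   If the spectral gap l is small, an eigenfunction is nearly a martingale before time 1/l,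
   so the walk does not visit both its maximum and its minimum, and a whole column is missed.
   If l is large, no level is visited more than |G|^(1 - delta/2) times before time
   |G|^(2 (1 - delta)), so by isoperimetry the unvisited part of each level has a component
   with more than half of the vertices; those of consecutive levels meet. *)

Require Import Defs.
From mathcomp Require Import all_boot all_order all_algebra.
From mathcomp Require Import zify ring lra.
From mathcomp Require Import all_classical all_reals all_analysis.
Set Implicit Arguments.
Unset Strict Implicit.
Unset Printing Implicit Defensive.
Import Order.TTheory GRing.Theory Num.Theory.
Import numFieldNormedType.Exports.
Local Open Scope classical_set_scope.
Local Open Scope ring_scope.

Arguments nbrs : simpl never.

(** * Finite-horizon expectations of the walk *)

Section Walk.
Variables (G : sgraph) (R : realType).
Local Notation E := (cylinder G).
Implicit Types (x y z : E) (p s : seq E) (h : E -> R) (F : seq E -> R).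

(** No stopping times and no strong Markov property appear: every probability is bounded on a finite
    horizon by feeding the trajectory to an automaton and exhibiting a function of state, position
    and remaining time that dominates its own one-step average. This packs an optional-stopping
    argument into one local inequality. The obstacle for the upper bound is that nothing is known
    about the geometry of the base beyond connectedness and bounded degree. The logarithm in the
    oscillation bound is universal all the same: a path in the base times the heights is a piece of
    a half-plane, and a triangle in it carries the comparison. The exponent 4 is 2 * (1 + 1), with
    one logarithm from h and one from the number of rounds; epsilon absorbs the constants. The two
    ranges of the gap are those in which a lower bound works: either |G|^(2 (1 - delta)) times the
    gap tends to 0, or |G|^(1 - delta/2) visited points per level stay below the isoperimetric
    threshold, of order |G|^(1 - delta/10). *)

Definition avg h x : R := (\sum_(z <- nbrs x) h z) / (size (nbrs x))%:R.

(** The recursion on the first step makes the Markov property definitional. The list is the whole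
    trajectory up to time [N], so [F] may be any functional of it; [law_le_Ex] is the bridge back to
    [srw_law]. *)
Fixpoint Ex (N : nat) x F : R :=
  if N is N'.+1 then avg (fun z => Ex N' z (fun p => F (x :: p))) x
  else F [:: x].

Lemma size_nbrs_gt0 x : 0 < (size (nbrs x))%:R :> R.
Proof. by rewrite ltr0n. Qed.

Lemma ler_avg h h' x : (forall z, z \in nbrs x -> h z <= h' z) ->
  avg h x <= avg h' x.
Proof.
move=> hh'; rewrite ler_pM2r ?invr_gt0 ?size_nbrs_gt0//.
by rewrite big_seq [leRHS]big_seq; apply: ler_sum.
Qed.

Lemma eq_avg h h' x : (forall z, z \in nbrs x -> h z = h' z) ->
  avg h x = avg h' x.
Proof. by move=> hh'; congr (_ / _); apply: eq_big_seq. Qed.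

Lemma avg_cst (c : R) x : avg (fun=> c) x = c.
Proof.
rewrite /avg big_const_seq count_predT iter_addr_0 -[c *+ _]mulr_natr mulfK//.
by rewrite gt_eqF// size_nbrs_gt0.
Qed.

Lemma avgD h h' x : avg (fun z => h z + h' z) x = avg h x + avg h' x.
Proof. by rewrite /avg big_split/= mulrDl. Qed.

Lemma avgZ (c : R) h x : avg (fun z => c * h z) x = c * avg h x.
Proof. by rewrite /avg -mulr_sumr mulrA. Qed.

Lemma avgN h x : avg (fun z => - h z) x = - avg h x.
Proof. by rewrite /avg sumrN mulNr. Qed.

Lemma ler_Ex N x F F' : (forall p, F p <= F' p) -> Ex N x F <= Ex N x F'.
Proof.
elim: N x F F' => [|N IH] x F F' FF'/=; first exact: FF'.
by apply: ler_avg => z _; apply: IH.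
Qed.

Lemma ExD N x F F' :
  Ex N x (fun p => F p + F' p) = Ex N x F + Ex N x F'.
Proof.
elim: N x F F' => [//|N IH] x F F' /=.
by rewrite -avgD; apply: eq_avg => z _; rewrite IH.
Qed.

Lemma ExZ N x (c : R) F : Ex N x (fun p => c * F p) = c * Ex N x F.
Proof.
elim: N x F => [//|N IH] x F /=.
by rewrite -avgZ; apply: eq_avg => z _; rewrite IH.
Qed.

Lemma Ex_sum N x (I : Type) (r : seq I) (F : I -> seq E -> R) :
  Ex N x (fun p => \sum_(i <- r) F i p) = \sum_(i <- r) Ex N x (F i).
Proof.
elim: r => [|i r IH].
  rewrite big_nil -[RHS](mul0r (Ex N x (fun=> 0))) -ExZ.
  by congr Ex; apply/funext => p; rewrite big_nil mul0r.
rewrite big_cons -IH -ExD; congr Ex; apply/funext => p.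
by rewrite big_cons.
Qed.

(* [upd] is an automaton reading the trajectory and [Phi k s x] dominates the
   expectation of the terminal value when [k] steps remain from [x] in state [s]. *)
Lemma Ex_automaton (S : Type) (upd : S -> E -> S) (Inv : S -> E -> Prop)
    (Phi : nat -> S -> E -> R) :
  (forall a x z, Inv a x -> z \in nbrs x -> Inv (upd a z) z) ->
  (forall k a x, Inv a x ->
     avg (fun z => Phi k (upd a z) z) x <= Phi k.+1 a x) ->
  forall N a0 x F, Inv (upd a0 x) x ->
    (forall p y, Inv (foldl upd a0 (rcons p y)) y ->
       F (rcons p y) <= Phi 0%N (foldl upd a0 (rcons p y)) y) ->
    Ex N x F <= Phi N (upd a0 x) x.
Proof.
move=> invS step; elim=> [|N IH] a0 x F inv FP /=; first exact: (FP [::] x).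
apply: le_trans (step _ _ _ inv); apply: ler_avg => z zx.
apply: IH => [|p y invp]; first exact: invS zx.
exact: (FP (x :: p) y).
Qed.

Fixpoint paths (N : nat) x : seq (seq E) :=
  if N is N'.+1 then [seq x :: s | z <- nbrs x, s <- paths N' z]
  else [:: [:: x]].

Lemma mem_pathsS N x s : s \in paths N.+1 x <->
  exists z p, [/\ z \in nbrs x, p \in paths N z & s = x :: p].
Proof. by split => [/allpairsPdep|] //; move=> h; apply/allpairsPdep. Qed.

Lemma paths_head N x s : s \in paths N x -> size s = N.+1 /\ head x s = x.
Proof.
elim: N x s => [|N IH] x s; first by rewrite inE => /eqP->.
by case/mem_pathsS => z [p [_ /IH[sp _] ->]] /=; rewrite sp.
Qed.

Lemma path_prob_ext x N (e e' : nat -> E) :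
  (forall i, (i <= N)%N -> e i = e' i) -> path_prob R x N e = path_prob R x N e'.
Proof.
move=> ee'; rewrite /path_prob ee'//; congr (_ * _).
by apply: eq_bigr => i _; rewrite !ee'// ltnW.
Qed.

Lemma path_prob_rec x N (e : nat -> E) :
  path_prob R x N.+1 e =
  (e 0%N == x)%:R * step_prob R x (e 1%N) * path_prob R (e 1%N) N (e \o S).
Proof.
rewrite /path_prob big_ord_recl/= eqxx mul1r !mulrA.
by case: eqP => [->|]//; rewrite !mul0r.
Qed.

Lemma path_prob_notin x N s : size s = N.+1 -> s \notin paths N x ->
  path_prob R x N (nth x s) = 0.
Proof.
elim: N x s => [|N IH] x [|y [|z s]]//=.
  by rewrite inE /path_prob big_ord0 /=; case: (eqVneq y x) => [->|]; rewrite ?eqxx// mul0r.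
move=> [sN]; rewrite path_prob_rec/=; case: eqP => [->|]; last by rewrite !mul0r.
move=> nin; rewrite mul1r {1}/step_prob; case: ifP => [xz|]; last by rewrite mul0r.
rewrite (@path_prob_ext _ _ _ (nth z (z :: s))); last first.
  by move=> i iN /=; apply: set_nth_default; rewrite /= sN.
rewrite IH ?mulr0//=; first by rewrite sN.
apply: contra nin => zs; apply/mem_pathsS; exists z, (z :: s).
by rewrite mem_nbrs.
Qed.

Lemma Ex_paths N x F :
  Ex N x F = \sum_(s <- paths N x) path_prob R x N (nth x s) * F s.
Proof.
elim: N x F => [|N IH] x F.
  by rewrite big_seq1 /path_prob big_ord0 /= eqxx !mul1r.
rewrite -[Ex N.+1 x F]/(avg (fun z => Ex N z (fun p => F (x :: p))) x).
rewrite -[paths N.+1 x]/([seq x :: s | z <- nbrs x, s <- paths N z]).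
rewrite big_allpairs_dep /avg mulr_suml.
apply: eq_big_seq => z zx /=; rewrite IH mulr_suml; apply: eq_big_seq => s sz.
have [ss hs] := paths_head sz.
case: s ss hs sz => [//|z' s] ss /= hs sz; rewrite hs path_prob_rec /= eqxx mul1r.
rewrite /step_prob -mem_nbrs zx mulrAC; congr (_ * _); rewrite mulrC; congr (_ * _).
apply: path_prob_ext => i iN /=; apply: set_nth_default.
by move: ss => /= ->.
Qed.

Let cyl N x s : set (trajectory G) := path_cylinder N (nth x s).

Lemma measurable_bigcup_seq (D : set (seq E)) (C : seq E -> set (trajectory G)) :
  (forall s, measurable (C s)) -> measurable (\bigcup_(s in D) C s).
Proof.
move=> mC; rewrite bigcup_mkcond; apply: countable_bigcupT_measurable => // s.
by case: ifP.
Qed.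

(** [E] is countable, so there are only countably many prefixes of length [N + 1], and the event is
    the union of the cylinders over those that satisfy it. *)
Lemma measurable_prefix N (Q : set (nat -> E)) :
  (forall X Y : nat -> E, (forall i, (i <= N)%N -> X i = Y i) -> Q X -> Q Y) ->
  measurable (Q : set (trajectory G)).
Proof.
move=> QN.
pose x0 : E := point.
pose D := [set s : seq E | size s = N.+1 /\ Q (nth x0 s)].
have -> : Q = \bigcup_(s in D) path_cylinder N (nth x0 s).
  apply/seteqP; split => [X QX|X [s [ss Qs] Xs]]; last first.
    by apply: QN Qs => i iN; rewrite Xs.
  exists (mkseq X N.+1).
    split; first by rewrite size_mkseq.
    by apply: QN QX => i iN; rewrite nth_mkseq.
  by move=> i iN; rewrite nth_mkseq.
by apply: measurable_bigcup_seq => s; apply: path_cylinder_measurable.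
Qed.

(** All bad events are bounded from above, so subadditivity over the finitely many nearest-neighbour
    prefixes is enough. The other prefixes are countably many, each of weight 0. *)
Lemma law_le_Ex x N (Q : pred (seq E)) :
  (srw_law R x [set X | Q (mkseq X N.+1)] <= (Ex N x (fun p => (Q p)%:R))%:E)%E.
Proof.
set P := srw_law R x; set A := [set X | _].
pose B : set (trajectory G) := \bigcup_(s in [set` [seq s <- paths N x | Q s]]) cyl N x s.
pose D := [set s : seq E | size s = N.+1 /\ s \notin paths N x].
pose Z : set (trajectory G) := \bigcup_(s in D) cyl N x s.
have mc s : measurable (cyl N x s) by exact: path_cylinder_measurable.
have mA : measurable (A : set (trajectory G)).
  apply: (@measurable_prefix N) => X Y XY; rewrite /A /=.
  suff -> : mkseq X N.+1 = mkseq Y N.+1 by [].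
  by apply/eq_in_map => i; rewrite mem_iota => /andP[_ iN]; rewrite XY.
have AB : A `<=` B `|` Z.
  move=> X QX; have [inp|nin] := boolP (mkseq X N.+1 \in paths N x).
    left; exists (mkseq X N.+1); first by rewrite /= mem_filter inp andbT.
    by move=> i iN; rewrite nth_mkseq.
  right; exists (mkseq X N.+1); first by split; rewrite ?size_mkseq.
  by move=> i iN; rewrite nth_mkseq.
have mB : measurable B.
  by exact: measurable_bigcup_seq.
have mZ : measurable Z.
  by exact: measurable_bigcup_seq.
have Z0 : P Z = 0%E.
  apply/negligibleP => //.
  pose C k : set (trajectory G) :=
    if unpickle k is Some s then if `[< D s >] then cyl N x s else set0 else set0.
  apply: (@negligibleS _ _ _ P (\bigcup_k C k)).
    by move=> X [s Ds Xs]; exists (pickle s) => //; rewrite /C pickleK asboolT.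
  apply: negligible_bigcup => k; rewrite /C.
  case: unpickle => [s|]; last exact: negligible_set0.
  case: asboolP => [[ss sp]|_]; last exact: negligible_set0.
  apply/negligibleP; first exact: mc.
  by rewrite [LHS]srw_lawP path_prob_notin.
have PB : (P B <= (Ex N x (fun p => (Q p)%:R))%:E)%E.
  rewrite Ex_paths /B bigcup_seq big_filter.
  elim: (paths N x) => [|s l IH]; first by rewrite !big_nil measure0.
  rewrite !big_cons; case: ifP => Qs; last by rewrite mulr0 add0r; exact: IH.
  rewrite mulr1 EFinD.
  apply: le_trans (measureU2 _ _ _) _ => //; last first.
    by apply: leeD IH; rewrite [leLHS]srw_lawP.
  by apply: bigsetU_measurable => i _.
apply: le_trans PB.
apply: (@le_trans _ _ (P (B `|` Z))).
  by apply: le_measure; rewrite ?inE//; exact: measurableU.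
have PBZ : (P B + P Z <= P B)%E by rewrite Z0 adde0.
by apply: le_trans PBZ; exact: measureU2.
Qed.

End Walk.

(** * Deterministic criteria for disconnection *)

Section Disconnection.
Variable G : sgraph.
Local Notation E := (cylinder G).
Implicit Types (S : set E) (x y z w : E) (g : G) (u : int).

Lemma adjE_sym : symmetric (@adjE G).
Proof.
move=> y z; rewrite /adjE (eq_sym y.1) (eq_sym y.2) adj_sym.
by rewrite -normrN opprB.
Qed.

Lemma connected_off_refl S y : ~ S y -> connected_off S y y.
Proof. by move=> Sy; exists [::]; split=> // w; rewrite inE => /eqP->. Qed.

Lemma connected_off_trans S y z w :
  connected_off S y z -> connected_off S z w -> connected_off S y w.
Proof.
move=> [p [yp pz pS]] [q [zq qw qS]]; exists (p ++ q); split.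
- by rewrite cat_path yp pz.
- by rewrite last_cat pz.
move=> v; rewrite -cat_cons mem_cat => /orP[/pS//|vq]; apply: qS.
by rewrite inE vq orbT.
Qed.

Lemma connected_off_sym S y z : connected_off S y z -> connected_off S z y.
Proof.
move=> [p [yp pz pS]]; exists (rev (belast y p)); split.
- rewrite -pz rev_path; apply: sub_path yp => a b.
  by rewrite adjE_sym.
- by case: p pz {yp pS} => //= a p _; rewrite rev_cons last_rcons.
move=> w; rewrite inE mem_rev => wp; apply: pS.
by rewrite lastI mem_rcons inE pz.
Qed.

Lemma connected_off_step S y z : ~ S y -> ~ S z -> adjE y z -> connected_off S y z.
Proof.
move=> Sy Sz yz; exists [:: z]; split; rewrite /= ?yz//.
by move=> w; rewrite !inE => /orP[] /eqP->.
Qed.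

Lemma connected_off_end S y z : connected_off S y z -> ~ S y /\ ~ S z.
Proof.
move=> [p [_ pz pS]]; split; apply: pS; first by rewrite inE eqxx.
by rewrite -pz mem_last.
Qed.

Lemma adjE_up g u : adjE ((g, u) : E) (g, u + 1).
Proof. by rewrite /adjE /= eqxx /=; lia. Qed.

Lemma connected_off_not_disconnects S :
  (forall M : nat, exists g g', connected_off S (g, M%:Z) (g', - M%:Z)) ->
  ~ disconnects S.
Proof.
move=> SC [_ [M _ /(_ M (leqnn M))[C1 [C2 [[y1 _ C1E] [y2 _ C2E]]]]]].
case: (SC M) => g [g' gg'] C12 top bot; apply: C12.
have := top g M%:Z (lexx _); have := bot g' (- M%:Z) (lexx _).
rewrite -C1E -C2E /= => y2g' y1g.
have y12 : connected_off S y1 y2.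
  apply: connected_off_trans y1g _; apply: connected_off_trans gg' _.
  exact: connected_off_sym.
apply/seteqP; split => z /=; apply: connected_off_trans => //.
exact: connected_off_sym.
Qed.

(** Both lower bounds end here, with singletons for a missed column and giant components for a large
    gap: a vertex common to two consecutive sets gives the vertical step between the levels. *)
Lemma levels_not_disconnects S (U : int -> {set G}) :
  (forall u g g', g \in U u -> g' \in U u -> connected_off S (g, u) (g', u)) ->
  (forall u, exists2 g, g \in U u & g \in U (u + 1)) ->
  ~ disconnects S.
Proof.
move=> UC UU; apply: connected_off_not_disconnects => M.
have [g _ gM] := UU (M%:Z - 1); rewrite subrK in gM.
suff H : forall n : nat, exists2 g', g' \in U (M%:Z - n%:Z) &
    connected_off S (g, M%:Z) (g', M%:Z - n%:Z).
  have [g' _ h] := H (M + M)%N; exists g, g'.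
  by have <- : M%:Z - (M + M)%N%:Z = - M%:Z by lia.
elim=> [|n [g' g'U gg']]; first by exists g; rewrite ?subr0//; exact: UC.
have [k k1 k2] := UU (M%:Z - n.+1%:Z).
have uE : M%:Z - n.+1%:Z + 1 = M%:Z - n%:Z by lia.
rewrite uE in k2.
exists k => //; apply: connected_off_trans gg' _.
apply: connected_off_trans (UC _ _ _ g'U k2) _; apply: connected_off_sym.
apply: connected_off_step; last by rewrite -uE adjE_up.
  by have [] := connected_off_end (UC _ _ _ k1 k1).
by have [] := connected_off_end (UC _ _ _ k2 k2).
Qed.

Lemma column_not_disconnects S g : (forall u, ~ S (g, u)) -> ~ disconnects S.
Proof.
move=> gS; apply: (@levels_not_disconnects _ (fun=> [set g]%SET)) => [u h h'|u].
  by rewrite !inE => /eqP-> /eqP->; exact: connected_off_refl.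
by exists g; rewrite inE.
Qed.

Lemma connected_off_level S u g p : path (@adj G) g p ->
  (forall g', ~ S (g', u)) -> connected_off S (g, u) (last g p, u).
Proof.
move=> gp Su; elim: p g gp => [|g' p IH] g /=; first by move=> _; exact: connected_off_refl.
move=> /andP[gg' /IH]; apply: connected_off_trans; apply: connected_off_step => //.
by rewrite /adjE /= gg' !eqxx orbT.
Qed.

(** Discrete intermediate value property: an edge changes the height by at most 1. *)
Lemma path_crosses_level (u0 : int) y p : path (@adjE G) y p ->
  u0 <= y.2 -> (last y p).2 <= u0 -> exists2 w, w \in y :: p & w.2 = u0.
Proof.
elim: p y => [|z p IH] y /=.
  by move=> _ y0 y1; exists y; rewrite ?inE//; apply/eqP; rewrite eq_le y1 y0.
move=> /andP[yz zp] y0 l0.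
have [yu|yu] := eqVneq y.2 u0; first by exists y; rewrite ?inE ?eqxx.
have [|w wp wu] := IH z zp _ l0; last by exists w; rewrite // inE wp orbT.
by move: yz; rewrite /adjE => /orP[/andP[_]|/andP[/eqP + _]]; lia.
Qed.

Lemma finite_levels S : finite_set S -> exists B : nat, forall w, S w -> (`|w.2| < B)%N.
Proof.
move=> /finite_seqP[s ->]; exists (\sum_(w <- s) `|w.2|).+1%N => w /= ws.
by rewrite ltnS (big_rem w ws)/= leq_addr.
Qed.

Lemma covered_level_disconnects S u0 : connected_graph G -> finite_set S ->
  (forall g, S (g, u0)) -> disconnects S.
Proof.
move=> Gc Sf Su; split=> //; have [B SB] := finite_levels Sf.
have [g0 _] := cylinder_inhabited G.
exists B => // M /= BM.
have far g u : M%:Z <= u \/ u <= - M%:Z -> ~ S (g, u) by move=> uM /SB /=; lia.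
have Bu : (`|u0| < B)%N by exact: (SB _ (Su g0)).
pose C y := [set z | connected_off S y z].
(* Both ends at once: [v] climbs from [M] or descends from [- M]. A path of the base is followed
   inside the level [v 0], out of reach of [S], and then the column. *)
have join (v : nat -> int) : v 0%N = M%:Z /\ (forall k, v k.+1 = v k + 1) \/
    v 0%N = - M%:Z /\ (forall k, v k.+1 = v k - 1) ->
    forall g k, connected_off S (g0, v 0%N) (g, v k).
  move=> vP g k.
  have vfar j : M%:Z <= v j \/ v j <= - M%:Z.
    by case: vP => -[v0 vS]; [left|right]; elim: j => [|j]; rewrite ?vS; lia.
  have [p gp ->] := connectP (Gc g0 g).
  apply: connected_off_trans (connected_off_level gp _) => [|g']; last exact: far.
  elim: k => [|k IH]; first by apply: connected_off_refl; exact: far.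
  apply: connected_off_trans IH _; apply: connected_off_step; try exact: far.
  rewrite /adjE /= eqxx /=; apply/orP; left.
  by case: vP => -[_ ->]; lia.
exists (C (g0, M%:Z)), (C (g0, - M%:Z)); split.
- by exists (g0, M%:Z) => //; apply: far; left.
- by exists (g0, - M%:Z) => //; apply: far; right.
- move=> C12.
  have : C (g0, - M%:Z) (g0, - M%:Z) by apply: connected_off_refl; apply: far; right.
  rewrite -C12 => -[p [yp pl pS]].
  have [||[g u] wp /= wu] := path_crosses_level (u0 := u0) yp; first by rewrite /=; lia.
    by rewrite pl /=; lia.
  by apply: pS wp _; rewrite wu.
- move=> g u uM; have := join (fun k => M%:Z + k%:Z) _ g (absz (u - M%:Z)).
  rewrite addr0 /C /=; have -> : M%:Z + (absz (u - M%:Z))%:Z = u by lia.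
  by apply; left; split => // k; lia.
- move=> g u uM; have := join (fun k => - M%:Z - k%:Z) _ g (absz (u + M%:Z)).
  rewrite subr0 /C /=; have -> : - M%:Z - (absz (u + M%:Z))%:Z = u by lia.
  by apply; right; split => // k; lia.
Qed.

End Disconnection.

(** * Isoperimetry from the spectral gap *)

Section Isoperimetry.
Variables (G : sgraph) (R : realType).
Implicit Types (f : G -> R) (A S : {set G}).

Lemma card_vertex_gt0 : 0 < #|G|%:R :> R.
Proof. by rewrite ltr0n vertex_gt0. Qed.

Lemma dirichlet_ge0 f : 0 <= dirichlet f.
Proof.
rewrite mulr_ge0 ?invr_ge0 ?mulr_ge0 ?ler0n//.
by apply: sumr_ge0 => g _; apply: sumr_ge0 => g' _; exact: sqr_ge0.
Qed.

Lemma variance_unif_ge0 f : 0 <= variance_unif f.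
Proof.
by rewrite mulr_ge0 ?invr_ge0 ?ler0n//; apply: sumr_ge0 => g _; exact: sqr_ge0.
Qed.

Lemma variance_unif_eq0 f : variance_unif f = 0 -> forall g g', f g = f g'.
Proof.
move=> /eqP; rewrite mulf_eq0 invr_eq0 gt_eqF ?card_vertex_gt0//= => /eqP f0.
suff h g : f g = mean f by move=> g g'; rewrite !h.
have := @psumr_eq0P _ _ xpredT _ (fun g _ => sqr_ge0 (f g - mean f)) f0 g isT.
by move/eqP; rewrite sqrf_eq0 subr_eq0 => /eqP.
Qed.

Lemma spectral_gap_le f : spectral_gap G R * variance_unif f <= dirichlet f.
Proof.
have [fc|/existsNP[g /existsNP[g' fgg']]] := pselect (forall g g', f g = f g').
  suff -> : variance_unif f = 0 by rewrite mulr0 dirichlet_ge0.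
  rewrite /variance_unif big1 ?mulr0// => g _; apply/eqP; rewrite sqrf_eq0 subr_eq0.
  rewrite /mean (eq_bigr (fun=> f g)) => [|g' _]; last exact: fc.
  by rewrite sumr_const -[f g *+ _]mulr_natl mulKf ?eqxx ?gt_eqF ?card_vertex_gt0.
have v0 : 0 < variance_unif f.
  rewrite lt_neqAle variance_unif_ge0 andbT eq_sym; apply/eqP => /variance_unif_eq0 f0.
  exact: fgg'.
rewrite -ler_pdivlMr//; apply: ge_inf; last by exists f => //; exists g, g'.
by exists 0 => _ [h _ <-]; rewrite divr_ge0 ?dirichlet_ge0 ?variance_unif_ge0.
Qed.

Lemma card_nbrs_le (g : G) : (#|[set g' | adj g g']%SET| <= maxdeg G)%N.
Proof. exact: (leq_bigmax (F := fun g : G => #|[set g' | adj g g']%SET|)). Qed.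

(** The unions of connected components of the complement of [S], as a boolean so that a smallest one
    can be selected. *)
Definition closed_off S A :=
  (A \subset ~: S) && [forall g in A, forall g', (g' \notin S) && adj g g' ==> (g' \in A)].

Lemma closed_offP S A : reflect
  ((forall g, g \in A -> g \notin S) /\
   forall g g', g \in A -> g' \notin S -> adj g g' -> g' \in A) (closed_off S A).
Proof.
apply: (iffP andP) => -[AS Acl]; split.
- by move=> g /(fintype.subsetP AS); rewrite inE.
- move=> g g' gA g'S gg'; move/forall_inP: Acl => /(_ g gA)/forallP/(_ g').
  by rewrite g'S gg'.
- by apply/fintype.subsetP => g /AS; rewrite inE.
- by apply/forall_inP => g gA; apply/forallP => g'; apply/implyP => /andP[]; exact: Acl.
Qed.

Lemma indicator_variance A (a := #|A|%:R / #|G|%:R : R) :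
  variance_unif (fun g => (g \in A)%:R) = a * (1 - a) :> R.
Proof.
have n0 := card_vertex_gt0; set n : R := #|G|%:R in n0 *.
have sA : \sum_(g : G) (g \in A)%:R = #|A|%:R :> R.
  by rewrite -sum1_card natr_sum [RHS]big_mkcond/=; apply: eq_bigr => g _; case: ifP.
have mA : mean (fun g => (g \in A)%:R) = a by rewrite /mean sA mulrC.
rewrite /variance_unif mA -/n.
rewrite (eq_bigr (fun g => (1 - a *+ 2) * (g \in A)%:R + a ^+ 2)); last first.
  by move=> g _; case: (g \in A) => /=; ring.
have sa : \sum_(g : G) a ^+ 2 = n * a ^+ 2 by rewrite sumr_const mulr_natl.
have An : #|A|%:R = a * n by rewrite /a mulfVK// gt_eqF.
rewrite big_split/= -mulr_sumr sA sa An; clearbody n a; field; exact: lt0r_neq0.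
Qed.

(** Every edge leaving [A] ends in [S], so the boundary has at most [maxdeg G * #|S|] edges; their
    two orientations cancel the factor 1/2 of the Dirichlet form. *)
Lemma closed_off_dirichlet S A : closed_off S A ->
  dirichlet (fun g => (g \in A)%:R : R) <= (maxdeg G * #|S|)%:R / #|G|%:R.
Proof.
move=> /closed_offP[AS Acl]; rewrite /dirichlet.
have n0 := card_vertex_gt0.
have degS : \sum_(g : G) \sum_(g' : G | adj g g') (g \in S)%:R <= (maxdeg G * #|S|)%:R :> R.
  rewrite (bigID (mem S)) /= addrC big1 ?add0r; last first.
    by move=> g /negbTE->; rewrite big1.
  rewrite mulnC -sum_nat_const natr_sum; apply: ler_sum => g gS; rewrite gS.
  rewrite -natr_sum ler_nat sum1_card (leq_trans _ (card_nbrs_le g))//.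
  by apply: subset_leq_card; apply/fintype.subsetP => g'; rewrite inE.
have degS' : \sum_(g : G) \sum_(g' : G | adj g g') (g' \in S)%:R <= (maxdeg G * #|S|)%:R :> R.
  apply: le_trans degS; rewrite (exchange_big_dep xpredT)//=.
  apply: ler_sum => g _; rewrite le_eqVlt; apply/orP; left; apply/eqP.
  by apply: eq_bigl => g'; rewrite adj_sym.
rewrite mulrC invfM mulrA ler_pM2r ?invr_gt0// ler_pdivrMr//.
rewrite mulr_natr mulr2n; apply: le_trans (lerD degS degS').
rewrite -big_split; apply: ler_sum => g _ /=; rewrite -big_split.
apply: ler_sum => g' gg' /=.
have [gA|gA] := boolP (g \in A); have [g'A|g'A] := boolP (g' \in A);
  rewrite ?subrr ?expr0n ?addr_ge0 ?ler0n//= ?subr0 ?sub0r ?sqrrN expr1n.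
- have -> : g' \in S; last by rewrite lerDr ler0n.
  by apply: contraNT g'A => g'S; exact: Acl gg'.
- have -> : g \in S; last by rewrite lerDl ler0n.
  by apply: contraNT gA => gS; apply: (Acl g') => //; rewrite adj_sym.
Qed.

(* A minimal union of components of G \ S with more than |G|/4 vertices has more than
   |G|/2 of them by the isoperimetric inequality, so it cannot be split and is connected. *)
Lemma giant_component S :
  (maxdeg G * #|S|)%:R < spectral_gap G R * #|G|%:R / 8 -> (2 * #|S| <= #|G|)%N ->
  exists A, [/\ (#|G| < 2 * #|A|)%N, forall g, g \in A -> g \notin S &
    forall g g', g \in A -> g' \in A ->
      connect (fun h h' => [&& adj h h', h \notin S & h' \notin S]) g g'].
Proof.
move=> Sgap S2; have n0 := card_vertex_gt0.
have cS : closed_off S (~: S).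
  by apply/closed_offP; split => [g|g g' _]; rewrite inE.
have PS : closed_off S (~: S) && (#|G| < 4 * #|~: S|)%N.
  by rewrite cS /=; move: S2 (vertex_gt0 G); rewrite -(cardsC S); lia.
pose A := [arg min_(B < ~: S | closed_off S B && (#|G| < 4 * #|B|)%N) #|B|].
have : [/\ closed_off S A, (#|G| < 4 * #|A|)%N &
    forall B, closed_off S B -> (#|G| < 4 * #|B|)%N -> (#|A| <= #|B|)%N].
  rewrite /A; case: arg_minnP => // B /andP[B1 B2] Bmin; split => // C C1 C2.
  by apply: Bmin; rewrite C1.
case=> Acl A4 Amin.
have A2 : (#|G| < 2 * #|A|)%N.
  rewrite ltnNge; apply/negP => A2.
  have := le_trans (spectral_gap_le _) (closed_off_dirichlet Acl).
  rewrite indicator_variance; move: Sgap A4 A2; rewrite -(ltr_nat R) -(ler_nat R) !natrM.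
  set n : R := #|G|%:R in n0 *; set a : R := #|A|%:R.
  set l := spectral_gap G R; set e := (maxdeg G)%:R * #|S|%:R => h1 h2 h3 h4.
  have e0 : 0 <= e by rewrite mulr_ge0 ?ler0n.
  have l0 : 0 < l.
    have : 0 < l * n / 8 by exact: le_lt_trans h1.
    by rewrite pmulr_lgt0 ?invr_gt0 ?ltr0n// pmulr_lgt0.
  have : l * (a * (n - a)) <= e * n.
    move: h4; rewrite ler_pdivlMr// => h4.
    have := ler_wpM2r (ltW n0) h4.
    have -> // : l * (a / n * (1 - a / n)) * n * n = l * (a * (n - a)).
    by clearbody n; field; exact: lt0r_neq0.
  (* Origin of the 8: for n/4 < a <= n/2 the product a (n - a) exceeds n^2/8. *)
  apply/negP; rewrite -ltNge.
  have : e * n < l * n / 8 * n by rewrite ltr_pM2r.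
  move/lt_trans; apply.
  have -> : l * n / 8 * n = l * (n * n / 8) by clearbody n; field.
  rewrite ltr_pM2l//; nra.
exists A; split => //; first by case/closed_offP: Acl.
move=> g g' gA g'A; set e := fun h h' => _.
have [AS Acl'] := closed_offP _ _ Acl.
pose C := [set h | connect e g h]%SET.
have CA : C \subset A.
  apply/fintype.subsetP => h; rewrite inE => /connectP[p gp ->].
  elim: p g gA gp {C} => //= k p IH g gA /andP[/and3P[gk _ kS] kp].
  by apply: IH kp; exact: Acl' gk.
have Ccl : closed_off S C.
  apply/closed_offP; split => [h /(fintype.subsetP CA)/AS//|h h' hC h'S hh'].
  move: (hC); rewrite !inE => gh; apply: connect_trans gh (connect1 _).
  by rewrite /e hh' h'S AS// (fintype.subsetP CA).
have Dcl : closed_off S (A :\: C).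
  apply/closed_offP; split => [h|h h']; rewrite !inE => /andP[hC hA]; first exact: AS.
  move=> h'S hh'; rewrite (Acl' _ _ hA h'S hh') andbT.
  apply: contra hC => gh'; apply: connect_trans gh' (connect1 _).
  by rewrite /e adj_sym hh' h'S AS.
have gC : g \in C by rewrite inE.
have cC : (0 < #|C|)%N by apply/card_gt0P; exists g.
have := cardsID C A; rewrite (finset.setIidPr CA) => cD.
(* As [A] has more than half of the vertices, [C] or [A :\: C] has more than a quarter of them;
   minimality excludes the latter, which is smaller than [A]. *)
have AC : (#|A| <= #|C|)%N.
  have [C4|C4] := ltnP #|G| (4 * #|C|)%N; first exact: Amin.
  by have := Amin _ Dcl; lia.
have /eqP CE : C == A by rewrite eqEcard CA.
by move: g'A; rewrite -CE inE.
Qed.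

End Isoperimetry.

Lemma small_levels_not_disconnects (G : sgraph) (R : realType) (m : nat)
    (S : set (cylinder G)) (V : int -> {set G}) :
  (forall g u, S (g, u) -> g \in V u) -> (forall u, (#|V u| <= m)%N) ->
  (maxdeg G * m)%:R < spectral_gap G R * #|G|%:R / 8 -> (2 * m <= #|G|)%N ->
  ~ disconnects S.
Proof.
move=> SV Vm gm m2.
have giant u := @giant_component G R (V u).
have {}giant u : exists A : {set G}, [/\ (#|G| < 2 * #|A|)%N, forall g, g \in A -> g \notin V u &
    forall g g', g \in A -> g' \in A ->
      connect (fun h h' => [&& adj h h', h \notin V u & h' \notin V u]) g g'].
  apply: giant; first by apply: le_lt_trans gm; rewrite ler_nat leq_mul2l Vm orbT.
  by apply: leq_trans m2; rewrite leq_mul2l Vm.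
pose U u := sval (cid (giant u)).
have UP u := svalP (cid (giant u)).
apply: (@levels_not_disconnects _ _ U) => [u g g' gU g'U|u].
  have [_ UV /(_ _ _ gU g'U)/connectP[p gp ->]] := UP u.
  have gV := UV _ gU; elim: p g gp gV {gU} => [|k p IH] g /=.
    by move=> _ gV; apply: connected_off_refl => /SV; exact/negP.
  move=> /andP[/and3P[gk _ kV] kp] gV; apply: connected_off_trans (IH _ kp kV).
  apply: connected_off_step; [by move=> /SV; exact/negP..|].
  by rewrite /adjE /= gk !eqxx orbT.
have [c1 _ _] := UP u; have [c2 _ _] := UP (u + 1).
rewrite -/(U _) in c1; rewrite -/(U _) in c2.
set A := U u in c1 *; set B := U (u + 1) in c2 *.
have : (0 < #|A :&: B|)%N.
  have AB : (#|A :|: B| <= #|G|)%N by exact: max_card.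
  by have := cardsUI A B; lia.
by move=> /card_gt0P[g]; rewrite inE => /andP[]; exists g.
Qed.

(** * Eigenfunction of the spectral gap *)

Section RealContinuity.
Variables (R : realType) (U : topologicalType).
Implicit Types F : U -> R.

Lemma cont_sum (J : Type) (r : seq J) (P : pred J) (F : J -> U -> R) :
  (forall j, continuous (F j)) -> continuous (fun f => \sum_(j <- r | P j) F j f).
Proof. by move=> cF; apply: continuous_big => //; exact: add_continuous. Qed.

Lemma cont_mul F1 F2 :
  continuous F1 -> continuous F2 -> continuous (fun f => F1 f * F2 f).
Proof. by move=> c1 c2 f; exact: (cvgM (c1 f) (c2 f)). Qed.

Lemma cont_sub F1 F2 :
  continuous F1 -> continuous F2 -> continuous (fun f => F1 f - F2 f).
Proof. by move=> c1 c2 f; exact: (cvgB (c1 f) (c2 f)). Qed.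

Lemma cont_add F1 F2 :
  continuous F1 -> continuous F2 -> continuous (fun f => F1 f + F2 f).
Proof. by move=> c1 c2 f; exact: (cvgD (c1 f) (c2 f)). Qed.

Lemma cont_cst (c : R) : continuous (fun _ : U => c).
Proof. by move=> f; exact: cvg_cst. Qed.

End RealContinuity.

(** * Minimizers by compactness *)

Section BoxMinimizer.
Variables (R : realType) (I : eqType).
Let T : topologicalType := prod_topology (fun _ : I => R).

Lemma coord_cont (i : I) : continuous (fun f : T => f i : R).
Proof. exact: (@proj_continuous I (fun=> R) i). Qed.

(** Serves both the Rayleigh quotient and the energy of a potential. The latter lives on the
    infinite index set [G * nat], hence the product topology and Tychonoff's theorem. *)
Lemma box_minimizer (lo hi : I -> R) (C : set T) (Q : T -> R) :
  closed C -> continuous Q ->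
  (exists f : I -> R, (forall i, lo i <= f i <= hi i) /\ C f) ->
  exists f : I -> R, [/\ forall i, lo i <= f i <= hi i, C f &
    forall f' : I -> R, (forall i, lo i <= f' i <= hi i) -> C f' -> Q f <= Q f'].
Proof.
move=> cC cQ [f0 [b0 C0]].
pose B : set T := [set f : forall i, R | forall i, `[lo i, hi i]%classic (f i)].
have cB : compact B by apply: (@tychonoff I (fun=> R) (fun i => `[lo i, hi i]%classic)) => i; exact: segment_compact.
have [|f /set_mem[Bf Cf] fmin] := compact_EVT_min _ (compact_closedI cB cC) (continuous_subspaceT cQ).
  by exists f0; split => // i /=; rewrite in_itv.
exists f; split => // f' b' C'.
by apply: fmin; rewrite inE; split => // i /=; rewrite in_itv.
Qed.
End BoxMinimizer.

(** * Rayleigh quotient on mean-zero functions *)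

Section Eigenfunction.
Variables (G : sgraph) (R : realType).
Implicit Types (f a b : G -> R) (g : G).

Definition form a b : R :=
  2^-1 * \sum_(g : G) \sum_(g' : G | adj g g') (a g' - a g) * (b g' - b g).

Definition pt g0 : G -> R := fun g => (g == g0)%:R.

Lemma form_sym_sum a b :
  \sum_(g : G) \sum_(g' : G | adj g g') (a g' - a g) * b g' =
  - \sum_(g : G) \sum_(g' : G | adj g g') (a g' - a g) * b g.
Proof.
rewrite (exchange_big_dep xpredT)//= -sumrN; apply: eq_bigr => g _.
rewrite -sumrN; apply: eq_big => [g'|g' _]; first by rewrite adj_sym.
by rewrite -mulNr opprB.
Qed.

Lemma formE a b : form a b = - \sum_(g : G) \sum_(g' : G | adj g g') (a g' - a g) * b g.
Proof.
rewrite /form.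
under eq_bigr do under eq_bigr do rewrite mulrBr.
under eq_bigr do rewrite sumrB.
by rewrite sumrB form_sym_sum; field.
Qed.

Lemma form_pt a g0 : form a (pt g0) = - \sum_(g' : G | adj g0 g') (a g' - a g0).
Proof.
rewrite formE (bigD1 g0)//= [X in _ + X]big1 ?addr0 => [|g /negbTE gg0].
  by congr (- _); apply: eq_bigr => g' _; rewrite /pt eqxx mulr1.
by rewrite big1// => g' _; rewrite /pt gg0 mulr0.
Qed.

Lemma form_perturb a b (e : R) :
  form (fun g => a g + e * b g) (fun g => a g + e * b g) =
  form a a + 2 * e * form a b + e ^+ 2 * form b b.
Proof.
rewrite /form !(mulrCA _ 2^-1) -!mulrDr; congr (_ * _).
rewrite !mulr_sumr -!big_split /=; apply: eq_bigr => g _.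
rewrite !mulr_sumr -!big_split /=; apply: eq_bigr => g' _.
by ring.
Qed.

Lemma form_ge0 a : 0 <= form a a.
Proof.
rewrite mulr_ge0 ?invr_ge0//; apply: sumr_ge0 => g _; apply: sumr_ge0 => g' _.
by rewrite -expr2 sqr_ge0.
Qed.

Lemma linear_coef_eq0 (p q : R) : 0 <= q ->
  (forall e : R, 0 <= e * p + e ^+ 2 * q) -> p = 0.
Proof.
move=> q0 H; apply/eqP; apply/negPn/negP => p0.
(* [q + 1] replaces [q], which may be 0; the value at this point is - (p / (q + 1))^2. *)
have := H (- p / (q + 1)).
have q1 : 0 < q + 1 by lra.
have -> : - p / (q + 1) * p + (- p / (q + 1)) ^+ 2 * q = - (p / (q + 1)) ^+ 2.
  by field; exact: lt0r_neq0.
by rewrite oppr_ge0 leNgt exprn_even_gt0//= mulf_neq0// invr_eq0 gt_eqF.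
Qed.

Lemma dirichletE f : dirichlet f = form f f / #|G|%:R.
Proof.
rewrite /dirichlet /form invfM -!mulrA; congr (_ * _); by rewrite mulrC.
Qed.

Lemma sum_sub_mean f : \sum_(g : G) (f g - mean f) = 0.
Proof.
rewrite sumrB sumr_const -[_ *+ _]mulr_natl /mean mulrA mulfV ?mul1r ?subrr//.
by rewrite gt_eqF// card_vertex_gt0.
Qed.

Lemma form_shift f (c : R) : form (fun g => f g - c) (fun g => f g - c) = form f f.
Proof.
congr (_ * _); apply: eq_bigr => g _; apply: eq_bigr => g' _; ring.
Qed.

Definition sumsq f : R := \sum_(g : G) f g ^+ 2.

(** The unit sphere of the mean-zero functions is closed and lies in the cube [-1, 1]^G; homogeneity
    extends the minimality to all mean-zero functions. *)
Lemma rayleigh_minimizer : (2 <= #|G|)%N ->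
  exists f, [/\ \sum_(g : G) f g = 0, sumsq f = 1 &
    forall h, \sum_(g : G) h g = 0 -> form f f * sumsq h <= form h h].
Proof.
move=> n2; pose T : topologicalType := prod_topology (fun _ : G => R).
have normalize h : \sum_(g : G) h g = 0 -> sumsq h != 0 ->
    exists c : R, [/\ c != 0, sumsq (fun g => c * h g) = 1 & \sum_(g : G) c * h g = 0].
  move=> h0 hn0.
  have hp : 0 < sumsq h by rewrite lt_neqAle eq_sym hn0/=; apply: sumr_ge0 => g _; exact: sqr_ge0.
  exists (Num.sqrt (sumsq h))^-1; split.
  - by rewrite invr_eq0 gt_eqF// sqrtr_gt0.
  - rewrite /sumsq; under eq_bigr do rewrite exprMn.
    by rewrite -mulr_sumr exprVn sqr_sqrtr ?mulVf// ltW.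
  - by rewrite -mulr_sumr h0 mulr0.
have in_box h : sumsq h = 1 -> forall g, (-1 : R) <= h g <= 1.
  move=> h1 g; rewrite -ler_norml -(@ler_pXn2r _ 2)// ?nnegrE// expr1n.
  rewrite real_normK ?num_real// -h1 /sumsq (bigD1 g)//= lerDl.
  by apply: sumr_ge0 => k _; exact: sqr_ge0.
pose C : set T := [set f : G -> R | \sum_(g : G) f g = 0] `&` [set f : G -> R | sumsq f = 1].
have cc := @coord_cont R G.
have cC : closed C.
  apply: closedI.
    apply: (@closed_comp T R (fun f : G -> R => \sum_(g : G) f g) [set 0]).
      by move=> f _; apply: cont_sum.
    exact: closed_eq.
  apply: (@closed_comp T R (fun f : G -> R => sumsq f) [set 1]); last exact: closed_eq.
  move=> f _; apply: cont_sum => g; apply: cont_mul; exact: cc.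
have cQ : continuous (fun f : T => form f f).
  apply: cont_mul; first exact: cont_cst.
  apply: cont_sum => g; apply: cont_sum => g'.
  by apply: cont_mul; apply: cont_sub; exact: cc.
have [f [_ [f0 f1] fmin]] : exists f : G -> R, [/\ forall i, (-1 : R) <= f i <= 1, C f &
    forall f' : G -> R, (forall i, (-1 : R) <= f' i <= 1) -> C f' -> form f f <= form f' f'].
  apply: (@box_minimizer R G (fun=> -1) (fun=> 1) C (fun f : T => form f f)) => //.
  (* The normalized difference of two point masses shows that the sphere is not empty. *)
  have [g [g' [_ _ gg']]] := card_gt1P n2.
  pose h k : R := pt g k - pt g' k.
  have h0 : \sum_(k : G) h k = 0.
    rewrite sumrB /pt -!natr_sum -!big_mkcond /= !big_pred1_eq subrr //.
  have h1 : sumsq h != 0.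
    rewrite gt_eqF// /sumsq (bigD1 g)//= ltr_pwDl//.
      by rewrite /h /pt eqxx (negbTE gg') subr0 expr1n.
    by apply: sumr_ge0 => k _; exact: sqr_ge0.
  have [c [_ c1 c0]] := normalize _ h0 h1.
  by exists (fun k => c * h k); split; [exact: in_box|].
exists f; split => // h h0.
have [->|hn0] := eqVneq (sumsq h) 0; first by rewrite mulr0 form_ge0.
have [c [cn0 c1 c0]] := normalize _ h0 hn0.
have := fmin _ (in_box _ c1) (conj c0 c1).
have -> : form (fun g => c * h g) (fun g => c * h g) = c ^+ 2 * form h h.
  rewrite /form [RHS]mulrCA [X in _ = _ * X]mulr_sumr; congr (_ * _); apply: eq_bigr => g _.
  by rewrite mulr_sumr; apply: eq_bigr => g' _; ring.
have : c ^+ 2 * sumsq h = 1.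
  by rewrite -c1 /sumsq mulr_sumr; apply: eq_bigr => g _; rewrite exprMn.
have c2 : 0 < c ^+ 2 by rewrite exprn_even_gt0.
move=> ch fch; rewrite -(ler_pM2l c2); apply: le_trans fch.
by rewrite mulrCA ch mulr1.
Qed.

(** Euler-Lagrange equation in unconstrained form: with [l = form f f], the quadratic form
    [form h h - l * sumsq h] is nonnegative on mean-zero functions and vanishes at [f], so its first
    variation at [f] is zero. *)
Lemma eigenfunction : (2 <= #|G|)%N ->
  exists f l, [/\ \sum_(g : G) f g = 0, exists g, f g != 0, 0 <= l <= spectral_gap G R &
    forall g, \sum_(g' : G | adj g g') (f g' - f g) = - l * f g].
Proof.
move=> n2; have [f [f0 f1 fmin]] := rayleigh_minimizer n2.
have n0 := card_vertex_gt0 G R.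
exists f, (form f f); split => //.
- apply/not_existsP => fz; move: f1; rewrite /sumsq big1 => [/eqP|g _].
    by rewrite eq_sym oner_eq0.
  by have /negP/negPn/eqP -> := fz g; rewrite expr0n.
- rewrite form_ge0 /=; apply: lb_le_inf.
    have [g [g' [_ _ gg']]] := card_gt1P n2.
    exists (dirichlet (pt g) / variance_unif (pt g)), (pt g) => //.
    exists g, g'; rewrite /pt eqxx eq_sym (negbTE gg'); apply/eqP; exact: oner_neq0.
  move=> _ [h [g [g' hgg']] <-].
  have v0 : 0 < variance_unif h.
    rewrite lt_neqAle variance_unif_ge0 andbT eq_sym; apply/eqP => /variance_unif_eq0 h0.
    exact: hgg'.
  rewrite ler_pdivlMr// dirichletE ler_pdivlMr// -(form_shift h (mean h)).
  apply: le_trans (fmin _ (sum_sub_mean h)).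
  by rewrite /variance_unif /sumsq -mulrA [X in _ * X]mulrC mulVKf// gt_eqF.
move=> g.
pose u : R := #|G|%:R^-1.
suff : 2 * (form f (pt g) - form f f * f g) = 0.
  move/eqP; rewrite mulf_eq0 pnatr_eq0/= subr_eq0 form_pt mulNr => /eqP <-.
  by rewrite opprK.
(* The point mass is projected on the mean-zero functions, where the minimality holds; subtracting a
   constant changes neither [form f] nor, as [f] has mean zero, the scalar product with [f]. *)
pose b k : R := pt g k - u.
have bs : \sum_(k : G) b k = 0.
  rewrite sumrB sumr_const -[_ *+ _]mulr_natr mulVf ?gt_eqF//.
  by rewrite /pt -natr_sum -big_mkcond /= big_pred1_eq subrr.
have fb : form f b = form f (pt g).
  congr (_ * _); apply: eq_bigr => k _; apply: eq_bigr => k' _; rewrite /b; ring.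
have fb2 : \sum_(k : G) f k * b k = f g.
  under eq_bigr do rewrite mulrBr.
  rewrite sumrB -mulr_suml f0 mul0r subr0 (bigD1 g)//= big1 ?addr0.
    by rewrite /pt eqxx mulr1.
  by move=> k /negbTE kg; rewrite /pt kg mulr0.
have hs e : sumsq (fun k => f k + e * b k) = 1 + 2 * e * f g + e ^+ 2 * sumsq b.
  transitivity (sumsq f + 2 * e * (\sum_(k : G) f k * b k) + e ^+ 2 * sumsq b).
    rewrite /sumsq !mulr_sumr -!big_split /=.
    by apply: eq_bigr => k _; ring.
  by rewrite f1 fb2.
have he e : \sum_(k : G) (f k + e * b k) = 0.
  by rewrite big_split /= -mulr_sumr bs mulr0 addr0.
apply: (@linear_coef_eq0 _ (form b b)) => [|e]; first exact: form_ge0.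
have := fmin _ (he e); rewrite hs form_perturb fb.
have : 0 <= form f f * (e ^+ 2 * sumsq b).
  apply: mulr_ge0; first exact: form_ge0.
  by apply: mulr_ge0; [exact: sqr_ge0|apply: sumr_ge0 => k _; exact: sqr_ge0].
lra.
Qed.

End Eigenfunction.

(** * Potential of a point in the half-cylinder *)

Section Sobolev.
Variable R : realType.

(** Inductive step of the Cauchy-Schwarz inequality without square roots: the cross term is
    controlled by [x ^+ 2 * y ^+ 2 <= (H * s) * (w * T)] and the inequality of the means. *)
Lemma cauchy_schwarz_step (x y H T w s : R) :
  0 <= H -> 0 <= T -> 0 <= w -> 0 <= s -> x ^+ 2 <= H * T -> y ^+ 2 <= w * s ->
  (x + y) ^+ 2 <= (H + w) * (T + s).
Proof.
move=> H0 T0 w0 s0 xHT yws.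
suff xy : 2 * (x * y) <= H * s + w * T.
  have -> : (x + y) ^+ 2 = x ^+ 2 + 2 * (x * y) + y ^+ 2 by ring.
  have -> : (H + w) * (T + s) = H * T + (H * s + w * T) + w * s by ring.
  by apply: lerD => //; apply: lerD.
have B0 : 0 <= H * s + w * T by rewrite addr_ge0 ?mulr_ge0.
apply: le_trans (ler_norm _) _.
rewrite -(@ler_pXn2r _ 2)// ?nnegrE// real_normK ?num_real//.
have : (x ^+ 2) * (y ^+ 2) <= (H * T) * (w * s) by rewrite ler_pM ?sqr_ge0.
have -> : (2 * (x * y)) ^+ 2 = 4 * (x ^+ 2 * y ^+ 2) by ring.
have -> : H * T * (w * s) = (H * s) * (w * T) by ring.
have := sqr_ge0 (H * s - w * T).
move: (H * s) (w * T) (x ^+ 2 * y ^+ 2) => p q z.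
have -> : (p - q) ^+ 2 = p ^+ 2 - 2 * (p * q) + q ^+ 2 by ring.
have -> : (p + q) ^+ 2 = p ^+ 2 + 2 * (p * q) + q ^+ 2 by ring.
move: (p ^+ 2) (q ^+ 2) (p * q) => *; lra.
Qed.

Lemma sum_cauchy_schwarz (m : nat) (d w s : nat -> R) :
  (forall i, 0 <= w i) -> (forall i, 0 <= s i) ->
  (forall i, (i < m)%N -> d i ^+ 2 <= w i * s i) ->
  (\sum_(i < m) d i) ^+ 2 <= (\sum_(i < m) w i) * (\sum_(i < m) s i).
Proof.
move=> w0 s0; elim: m => [|m IH] dws; first by rewrite !big_ord0 expr0n mul0r.
rewrite !big_ord_recr /=; apply: cauchy_schwarz_step => //.
- by apply: sumr_ge0.
- by apply: sumr_ge0.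
- by apply: IH => i im; apply: dws; exact: ltnW.
- exact: dws.
Qed.

Lemma sqr_sum_le (m : nat) (d : nat -> R) :
  (\sum_(i < m) d i) ^+ 2 <= m%:R * \sum_(i < m) d i ^+ 2.
Proof.
have := @sum_cauchy_schwarz m d (fun=> 1) (fun i => d i ^+ 2).
rewrite sumr_const card_ord; apply => // i *; rewrite ?sqr_ge0// mul1r//.
Qed.

Lemma sum_by_parts (a : nat -> R) k :
  k%:R * a k - \sum_(j < k) a j = \sum_(j < k) j.+1%:R * (a j.+1 - a j).
Proof.
elim: k => [|k IH]; first by rewrite !big_ord0 mul0r subrr.
by rewrite !big_ord_recr /= -IH -natr1; ring.
Qed.

Definition harmonic (m : nat) : R := \sum_(i < m) i.+1%:R^-1.

Definition col_avg (a : nat -> R) (m : nat) : R := (\sum_(j < m.+1) a j) / m.+1%:R.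

(** Source of the logarithm. The apex is compared with averages over columns of [i + 1] points: the
    squared increment from one column to the next is at most 2 / (i + 1) times the energy between
    them, and Cauchy-Schwarz with these weights gives the harmonic sum. *)
Lemma triangle_bound (F : nat -> nat -> R) m :
  (col_avg (F m) m - F 0%N 0%N) ^+ 2 <= 2 * harmonic m *
    \sum_(i < m) \sum_(j < i.+1)
       ((F i.+1 j - F i j) ^+ 2 + (F i.+1 j.+1 - F i.+1 j) ^+ 2).
Proof.
pose A i := col_avg (F i) i.
pose e (i : nat) : R := \sum_(j < i.+1)
       ((F i.+1 j - F i j) ^+ 2 + (F i.+1 j.+1 - F i.+1 j) ^+ 2).
have e0 i : 0 <= e i by apply: sumr_ge0 => j _; rewrite addr_ge0 ?sqr_ge0.
have -> : col_avg (F m) m - F 0%N 0%N = \sum_(i < m) (A i.+1 - A i).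
  rewrite -(big_mkord xpredT (fun i => A i.+1 - A i)) telescope_sumr//.
  by rewrite /A /col_avg big_ord1 divr1.
rewrite mulrAC (mulrC _ (harmonic m)) mulr_sumr.
apply: (@sum_cauchy_schwarz m (fun i => A i.+1 - A i) (fun i => i.+1%:R^-1) (fun i => 2 * e i)).
- by move=> i; rewrite invr_ge0.
- by move=> i; rewrite mulr_ge0.
move=> i _; set k : R := i.+1%:R.
have k0 : 0 < k by rewrite ltr0n.
(* Summation by parts turns the lengthening of the column from [i + 1] to [i + 2] points into
   vertical increments with weights (j + 1) / (i + 2), at most 1. *)
have dE : A i.+1 - A i = (\sum_(j < i.+1) ((F i.+1 j - F i j) +
     j.+1%:R / i.+2%:R * (F i.+1 j.+1 - F i.+1 j))) / k.
  have P := sum_by_parts (F i.+1) i.+1.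
  have k2 : i.+2%:R = k + 1 :> R by rewrite natr1.
  rewrite big_split /= sumrB.
  have -> : \sum_(j < i.+1) j.+1%:R / i.+2%:R * (F i.+1 j.+1 - F i.+1 j) =
      (\sum_(j < i.+1) j.+1%:R * (F i.+1 j.+1 - F i.+1 j)) / i.+2%:R.
    by rewrite mulr_suml; apply: eq_bigr => j _; rewrite mulrAC.
  rewrite -P /A /col_avg big_ord_recr /= k2 -/k.
  have k1 : 0 < k + 1 by lra.
  by field; rewrite !gt_eqF.
rewrite dE expr_div_n ler_pdivrMr ?exprn_gt0//.
apply: le_trans (sqr_sum_le i.+1 (fun j => (F i.+1 j - F i j) +
     j.+1%:R / i.+2%:R * (F i.+1 j.+1 - F i.+1 j))) _.
have -> : k^-1 * (2 * e i) * k ^+ 2 = k * (2 * e i) by field; exact: lt0r_neq0.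
rewrite ler_pM2l// mulr_sumr; apply: ler_sum => j _.
set b := _ / _; set x := F _ _ - _; set y := F _ _ - _.
have b1 : b ^+ 2 <= 1.
  rewrite expr_le1// ?divr_ge0// ler_pdivrMr ?ltr0n// mul1r ler_nat.
  by rewrite ltnS ltnW.
have := sqr_ge0 (x - b * y); have := ler_wpM2r (sqr_ge0 y) b1; rewrite mul1r.
have -> : (x - b * y) ^+ 2 = x ^+ 2 - 2 * (x * (b * y)) + b ^+ 2 * y ^+ 2 by ring.
have -> : (x + b * y) ^+ 2 = x ^+ 2 + 2 * (x * (b * y)) + b ^+ 2 * y ^+ 2 by ring.
move: (x ^+ 2) (y ^+ 2) (b ^+ 2 * y ^+ 2) (x * (b * y)) => *; lra.
Qed.

End Sobolev.

(** * Energy and equilibrium potential on the reflected cylinder *)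

Section Potential.
Variables (G : sgraph) (R : realType) (h : nat).
Implicit Types (a b phi : G -> nat -> R) (g : G).

(* Reflecting the cylinder at level 0 identifies [G * Z] with [G * nat], where the
   edges inside level 0 have conductance 1/2. *)
Definition conduct (j : nat) : R := if j == 0%N then 2^-1 else 1.

Definition energy a b : R := \sum_(j < h)
  (\sum_(g : G) (a g j.+1 - a g j) * (b g j.+1 - b g j) + conduct j * form (a^~ j) (b^~ j)).

(** At [j = 0] both vertical neighbours lie at height 1: this is the Laplacian of the unfolded
    cylinder on functions of the base point and of the distance to a level. *)
Definition lapl a g (j : nat) : R :=
  a g j.+1 + a g (if j is j'.+1 then j' else 1%N) - 2 * a g j +
  \sum_(g' : G | adj g g') (a g' j - a g j).

Definition pt2 g0 j0 : G -> nat -> R := fun g j => ((g == g0) && (j == j0))%:R.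

Lemma conduct_gt0 j : 0 < conduct j.
Proof. by rewrite /conduct; case: ifP; rewrite ?invr_gt0. Qed.

Lemma energy_perturb a b (e : R) :
  energy (fun g j => a g j + e * b g j) (fun g j => a g j + e * b g j) =
  energy a a + 2 * e * energy a b + e ^+ 2 * energy b b.
Proof.
rewrite /energy !mulr_sumr -!big_split /=; apply: eq_bigr => j _.
rewrite form_perturb !mulrDr !(mulrCA _ (conduct j)).
set X := form _ _; set Y := form _ _; set Z := form _ _.
have -> : \sum_(g : G) (a g j.+1 + e * b g j.+1 - (a g j + e * b g j)) *
   (a g j.+1 + e * b g j.+1 - (a g j + e * b g j)) =
   \sum_(g : G) (a g j.+1 - a g j) * (a g j.+1 - a g j) +
   2 * e * (\sum_(g : G) (a g j.+1 - a g j) * (b g j.+1 - b g j)) +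
   e ^+ 2 * (\sum_(g : G) (b g j.+1 - b g j) * (b g j.+1 - b g j)).
  rewrite !mulr_sumr -!big_split /=; apply: eq_bigr => g _; ring.
by ring.
Qed.

(** Green's formula against a point mass; at level 0 the vertical and the horizontal parts are both
    half of those of the unfolded cylinder. *)
Lemma energy_pt a g0 j0 : (j0 < h)%N -> energy a (pt2 g0 j0) = - (conduct j0 * lapl a g0 j0).
Proof.
move=> j0h; rewrite /energy big_split /=.
have -> : \sum_(j < h) conduct j * form (a^~ j) ((pt2 g0 j0)^~ j) =
    - (conduct j0 * \sum_(g' : G | adj g0 g') (a g' j0 - a g0 j0)).
  rewrite (bigD1 (Ordinal j0h))//= [X in _ + X]big1 ?addr0.
    rewrite -mulrN -form_pt; congr (_ * form _ _); apply/funext => g.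
    by rewrite /pt2 /pt eqxx andbT.
  move=> j; rewrite -val_eqE /= => /negbTE jj0.
  rewrite /form big1 ?mulr0// => g _; rewrite big1// => g' _.
  by rewrite /pt2 jj0 !andbF subrr mulr0.
have -> : \sum_(j < h) \sum_(g : G) (a g j.+1 - a g j) * (pt2 g0 j0 g j.+1 - pt2 g0 j0 g j) =
   \sum_(j < h) (a g0 j.+1 - a g0 j) * ((j.+1 == j0)%:R - (val j == j0)%:R).
  apply: eq_bigr => j _; rewrite (bigD1 g0)//= big1 ?addr0 => [|g /negbTE gg0].
    by rewrite /pt2 eqxx.
  by rewrite /pt2 gg0 subrr mulr0.
under eq_bigr do rewrite mulrBr.
rewrite sumrB.
have -> : \sum_(j < h) (a g0 j.+1 - a g0 j) * (val j == j0)%:R = a g0 j0.+1 - a g0 j0.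
  rewrite (bigD1 (Ordinal j0h))//= eqxx mulr1 big1 ?addr0// => j.
  by rewrite -val_eqE /= => /negbTE->; rewrite mulr0.
case: j0 j0h => [|j0] j0h.
  rewrite big1 => [|j _]; last by rewrite mulr0.
  by rewrite /lapl /conduct /=; field.
rewrite (bigD1 (Ordinal (ltnW j0h)))//= eqxx mulr1 big1 ?addr0 => [|j].
  by rewrite /lapl /conduct /=; ring.
by rewrite -val_eqE /= eqSS => /negbTE->; rewrite mulr0.
Qed.

Lemma lapl_pt g0 j0 : lapl (pt2 g0 j0) g0 j0 = - (2 + #|[set g' | adj g0 g']%SET|%:R).
Proof.
rewrite /lapl /pt2 !eqxx /= gtn_eqF ?ltnSn//.
have -> : (if j0 is j'.+1 then j' else 1%N) == j0 = false.
  by case: j0 => // j; apply/negbTE; rewrite neq_ltn ltnSn.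
rewrite (eq_bigr (fun=> -1)) => [|g' gg'].
  rewrite sumr_const cardsE -[- 1 *+ _]mulr_natr /=; ring.
case: eqP gg' => [->|_ _]; first by rewrite adj_irr.
by rewrite sub0r.
Qed.

(** Competitors for the equilibrium potential of [(g0, 0)] with zero values from height [h] on. The
    bounds 0 and 1 make them a box, so that compactness applies. *)
Definition admissible g0 phi : Prop :=
  [/\ forall g j, 0 <= phi g j <= 1, forall g j, (h <= j)%N -> phi g j = 0 & phi g0 0%N = 1].

Lemma potential_minimizer g0 : (0 < h)%N ->
  exists2 phi, admissible g0 phi & forall phi', admissible g0 phi' ->
     energy phi phi <= energy phi' phi'.
Proof.
move=> h0; pose I : eqType := (G * nat)%type.
(* A coordinate is pinned where the two bounds agree: at 1 at the pole, at 0 from height [h] on. *)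
pose lo (i : I) : R := (i == (g0, 0%N))%:R.
pose hi (i : I) : R := (i.2 < h)%N%:R.
pose T : topologicalType := prod_topology (fun _ : I => R).
pose cu (f : I -> R) : G -> nat -> R := fun g j => f (g, j).
have admP phi : admissible g0 phi <-> forall i : I, lo i <= phi i.1 i.2 <= hi i.
  split=> [[p01 ph pg] [g j]|H]; rewrite /lo /hi /=.
    case: eqP => [[-> ->]|_]; first by rewrite pg h0 !lexx.
    by case: ltnP => [_|/ph ->]; rewrite ?lexx.
  split=> [g j|g j hj|].
  - have /andP[] := H (g, j); rewrite /lo /hi /= => l1 l2; apply/andP; split.
      by apply: le_trans l1; rewrite ler0n.
    by apply: le_trans l2 _; rewrite lern1 leq_b1.
  - have /andP[] := H (g, j); rewrite /lo /hi /= ltnNge hj /= => l1 l2.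
    by apply/eqP; rewrite eq_le l2 (le_trans _ l1)// ler0n.
  - have := H (g0, 0%N); rewrite /lo /hi /= eqxx h0 => /andP[l1 l2]; apply/eqP; by rewrite eq_le l2 l1.
have cc := @coord_cont R I.
have cQ : continuous (fun f : T => energy (cu f) (cu f)).
  apply: cont_sum => j.
  have c1 : continuous (fun f : T => \sum_(g : G) (f (g, j.+1) - f (g, val j)) * (f (g, j.+1) - f (g, val j))).
    by apply: cont_sum => g; apply: cont_mul; apply: cont_sub; exact: cc.
  have c2 : continuous (fun f : T => conduct j * form (fun g => f (g, val j)) (fun g => f (g, val j))).
    apply: cont_mul; first exact: cont_cst.
    apply: cont_mul; first exact: cont_cst.
    apply: cont_sum => g; apply: cont_sum => g'.
    by apply: cont_mul; apply: cont_sub; exact: cc.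
  exact: (cont_add c1 c2).
have [||f [fb _ fmin]] := @box_minimizer R I lo hi setT _ _ cQ.
- exact: closedT.
- exists lo; split=> // i; rewrite lexx /lo /hi /=.
  by case: eqP => [->|_]; rewrite /= ?h0 ?ler0n.
have fa : admissible g0 (cu f) by apply/admP => -[g j]; exact: fb.
apply: (ex_intro2 _ _ (cu f) fa) => phi' /admP a'; apply: (fmin (fun i => phi' i.1 i.2)) => //.
Qed.

Lemma energy_le g0 phi : (0 < h)%N ->
  (forall phi', admissible g0 phi' -> energy phi phi <= energy phi' phi') ->
  energy phi phi <= #|G|%:R / h%:R.
Proof.
(* The competitor is linear in the height, so that only vertical edges count: [#|G| * h] of them,
   with increments of size 1 / h. *)
move=> h0 /(_ (fun _ j => (h - j)%:R / h%:R)) H.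
have hR : 0 < h%:R :> R by rewrite ltr0n.
apply: le_trans (H _) _.
  split=> [g j|g j|]; first by rewrite divr_ge0//= ler_pdivrMr// mul1r ler_nat leq_subr.
    by rewrite -subn_eq0 => /eqP->; rewrite mul0r.
  by rewrite subn0 mulfV// gt_eqF.
rewrite /energy (eq_bigr (fun=> #|G|%:R * h%:R^-1 ^+ 2)) => [|j _].
  rewrite sumr_const card_ord -[_ *+ _]mulr_natl expr2.
  by rewrite (mulrCA h%:R) (mulrA h%:R) mulfV ?mul1r// gt_eqF.
have -> : form (fun _ : G => (h - j)%:R / h%:R : R) (fun=> (h - j)%:R / h%:R) = 0.
  by rewrite /form big1 ?mulr0// => g _; rewrite big1// => g' _; rewrite subrr mulr0.
rewrite mulr0 addr0 sumr_const -[_ *+ _]mulr_natl; congr (_ * _).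
have -> : (h - j)%:R = (h - j.+1)%:R + 1 :> R.
  by rewrite natr1 -subSn// ltn_ord.
by field; rewrite gt_eqF.
Qed.

(** At a point of negative Laplacian, replacing the value by the average over the neighbours would
    lower it, keep it nonnegative and decrease the energy by [conduct j * (2 + d) * e ^+ 2]. *)
Lemma potential_subharmonic g0 phi g j : admissible g0 phi ->
  (forall phi', admissible g0 phi' -> energy phi phi <= energy phi' phi') ->
  (j < h)%N -> (g, j) != (g0, 0%N) -> 0 <= lapl phi g j.
Proof.
move=> [p01 ph pg] pmin jh gj0; rewrite leNgt; apply/negP => lneg.
set d : R := #|[set g' | adj g g']%SET|%:R.
have d2 : 0 < 2 + d by rewrite ltr_pwDl ?ler0n.
pose e := lapl phi g j / (2 + d).
have e0 : e < 0 by rewrite ltr_pdivrMr// mul0r.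
have c0 := conduct_gt0 j.
have pe : 0 <= phi g j + e.
  rewrite -(@pmulr_rge0 _ (2 + d))// mulrDr /e [X in _ + X]mulrC mulfVK ?gt_eqF//.
  rewrite /lapl sumrB sumr_const -[_ *+ _]mulr_natl -/d.
  have -> : #|(fun g' => adj g g')| = #|[set g' | adj g g']%SET| by rewrite cardsE.
  have nn k : 0 <= phi g k by case/andP: (p01 g k).
  have s0 : 0 <= \sum_(g' : G | adj g g') phi g' j.
    by apply: sumr_ge0 => g' _; case/andP: (p01 g' j).
  have := nn j.+1; have := nn (if j is j'.+1 then j' else 1%N).
  rewrite -/d; lra.
have adm : admissible g0 (fun g' j' => phi g' j' + e * pt2 g j g' j').
  split=> [g' j'|g' j' hj'|]; rewrite /pt2.
  - have /andP[l1 l2] := p01 g' j'.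
    case: eqP => [->|_]; last by rewrite /= mulr0 addr0 l1.
    case: eqP => [->|_]; last by rewrite /= mulr0 addr0; have := p01 g j'.
    rewrite /= mulr1 pe; have /andP[] := p01 g j; lra.
  - by rewrite ph// gtn_eqF ?(leq_trans jh)// andbF mulr0 addr0.
  - rewrite pg; case: eqP => [gg|_]; last by rewrite mulr0 addr0.
    case: eqP => [jj|_]; last by rewrite mulr0 addr0.
    by move: gj0; rewrite -gg -jj eqxx.
have := pmin _ adm; rewrite energy_perturb !energy_pt// lapl_pt -/d.
have -> : lapl phi g j = e * (2 + d) by rewrite /e mulfVK// gt_eqF.
have X0 : 0 < conduct j * (2 + d) * e ^+ 2.
  by apply: mulr_gt0; [exact: mulr_gt0|rewrite exprn_even_gt0//= lt_eqF].
rewrite -addrA; have -> : 2 * e * - (conduct j * (e * (2 + d))) + e ^+ 2 * - (conduct j * - (2 + d)) =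
  - (conduct j * (2 + d) * e ^+ 2) by ring.
by rewrite leNgt gtrDl oppr_lt0 X0.
Qed.

Lemma sum_inj_le (Q : nat -> G) (a : G -> R) k : (forall g, 0 <= a g) ->
  (forall i i', (i < k)%N -> (i' < k)%N -> Q i = Q i' -> i = i') -> \sum_(i < k) a (Q i) <= \sum_(g : G) a g.
Proof.
move=> a0 Qinj; rewrite -(big_mkord xpredT (fun i => a (Q i))) /index_iota subn0.
rewrite -(big_map Q xpredT a).
have uQ : uniq (map Q (iota 0 k)).
  rewrite map_inj_in_uniq ?iota_uniq// => i i'; rewrite !mem_iota /= add0n => ik i'k.
  exact: Qinj.
rewrite big_uniq//= [leRHS](bigID (mem (map Q (iota 0 k))))/= lerDl.
exact: sumr_ge0.
Qed.

Section Paths.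
Variables (phi : G -> nat -> R) (Q : nat -> G) (m : nat).
Hypothesis mh : (m <= h)%N.
Hypothesis Qinj : forall i i', (i <= m)%N -> (i' <= m)%N -> Q i = Q i' -> i = i'.
Hypothesis Qadj : forall i, (i < m)%N -> adj (Q i) (Q i.+1).

Lemma form_path_le (a : G -> R) (k : nat) : (k <= m)%N ->
  \sum_(i < k) (a (Q i.+1) - a (Q i)) ^+ 2 <= 2 * form a a.
Proof.
move=> km; rewrite /form mulrA mulfV ?mul1r//.
apply: le_trans (_ : \sum_(i < k) \sum_(g' : G | adj (Q i) g') (a g' - a (Q i)) * (a g' - a (Q i)) <= _).
  apply: ler_sum => i _; rewrite (bigD1 (Q i.+1)) /=; last exact/Qadj/(leq_trans (ltn_ord i)).
  by rewrite expr2 lerDl; apply: sumr_ge0 => g' _; rewrite -expr2 sqr_ge0.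
apply: (@sum_inj_le Q (fun g => \sum_(g' : G | adj g g') (a g' - a g) * (a g' - a g))).
  by move=> g; apply: sumr_ge0 => g' _; rewrite -expr2 sqr_ge0.
move=> i i' ik i'k; by apply: Qinj; [exact: leq_trans (ltnW ik) km|exact: leq_trans (ltnW i'k) km].
Qed.

(** Injectivity of the path keeps the edges of the triangle distinct. The 4 is the 2 of
    [form_path_le], which uses one orientation of each edge, times 2 for the conductance 1/2 at
    level 0. *)
Lemma path_energy_le : 
  \sum_(i < m) \sum_(j < i.+1)
     ((phi (Q i.+1) j - phi (Q i) j) ^+ 2 + (phi (Q i.+1) j.+1 - phi (Q i.+1) j) ^+ 2)
  <= 4 * energy phi phi.
Proof.
apply: le_trans (_ : \sum_(i < m) \sum_(j < h)
     ((phi (Q i.+1) j - phi (Q i) j) ^+ 2 + (phi (Q i.+1) j.+1 - phi (Q i.+1) j) ^+ 2) <= _).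
  apply: ler_sum => i _.
  have ih : (i.+1 <= h)%N by exact: leq_trans (ltn_ord i) mh.
  pose t j := (phi (Q i.+1) j - phi (Q i) j) ^+ 2 + (phi (Q i.+1) j.+1 - phi (Q i.+1) j) ^+ 2.
  rewrite -!(big_mkord xpredT t) (big_cat_nat _ ih)//= lerDl; apply: sumr_ge0 => j _.
  by rewrite addr_ge0 ?sqr_ge0.
rewrite exchange_big /energy mulr_sumr; apply: ler_sum => j _ /=.
rewrite big_split /= addrC mulrDr; apply: lerD.
  apply: le_trans (_ : \sum_(g : G) (phi g j.+1 - phi g j) ^+ 2 <= _).
    apply: (@sum_inj_le (Q \o S) (fun g => (phi g j.+1 - phi g j) ^+ 2)) => [g|i i' im i'm /=].
      exact: sqr_ge0.
    by move=> /(Qinj im i'm) [].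
  have s0 : 0 <= \sum_(g : G) (phi g j.+1 - phi g j) ^+ 2.
    by apply: sumr_ge0 => g _; exact: sqr_ge0.
  by rewrite (_ : \sum_(g : G) (phi g j.+1 - phi g j) ^+ 2 <= _ = true)//; lra.
apply: le_trans (@form_path_le (phi^~ j) m (leqnn m)) _.
rewrite mulrA ler_wpM2r ?form_ge0// /conduct; case: ifP => _; lra.
Qed.

Lemma col_avg_path_le : 
  (col_avg (phi (Q m)) m - phi (Q 0%N) 0%N) ^+ 2 <= 8 * harmonic R m * energy phi phi.
Proof.
apply: le_trans (triangle_bound (fun i j => phi (Q i) j) m) _.
have H0 : 0 <= harmonic R m by apply: sumr_ge0 => i _; rewrite invr_ge0.
have -> : 8 * harmonic R m * energy phi phi = 2 * harmonic R m * (4 * energy phi phi) by ring.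
by apply: ler_wpM2l path_energy_le; rewrite mulr_ge0.
Qed.

End Paths.

(** Crosses the middle edge of a path of odd length. *)
Lemma col_avg_adj_le phi g g' m : adj g g' -> (m < h)%N ->
  (col_avg (phi g') m - col_avg (phi g) m) ^+ 2 <= 4 * energy phi phi.
Proof.
move=> gg' mh; rewrite /col_avg -mulrBl -sumrB expr_div_n ler_pdivrMr ?exprn_gt0//.
apply: le_trans (sqr_sum_le m.+1 (fun j => phi g' j - phi g j)) _.
have s0 : 0 <= \sum_(j < m.+1) (phi g' j - phi g j) ^+ 2.
  by apply: sumr_ge0 => j _; exact: sqr_ge0.
have m1 : 1 <= m.+1%:R :> R by rewrite ler1n.
apply: le_trans (_ : m.+1%:R ^+ 2 * \sum_(j < m.+1) (phi g' j - phi g j) ^+ 2 <= _).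
  by rewrite ler_wpM2r// expr2 ler_peMl// ler0n.
rewrite mulrC ler_wpM2r ?exprn_ge0//.
apply: le_trans (_ : \sum_(j < h) (phi g' j - phi g j) ^+ 2 <= _).
  pose t j := (phi g' j - phi g j) ^+ 2.
  rewrite -!(big_mkord xpredT t) (big_cat_nat _ mh)//= lerDl; apply: sumr_ge0 => j _.
  exact: sqr_ge0.
rewrite /energy mulr_sumr; apply: ler_sum => j _.
pose Q i := if i is 0%N then g else g'.
have le2 : (phi g' j - phi g j) ^+ 2 <= 2 * form (phi^~ j) (phi^~ j).
  have := @form_path_le Q 1 _ _ (phi^~ j) 1 isT; rewrite big_ord1 /=; apply.
    move=> [|[|i]] [|[|i']]//= _ _ E; move: gg'; first by rewrite E adj_irr.
    by rewrite -E adj_irr.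
  by case.
rewrite mulrDr; apply: le_trans le2 _; rewrite -[leLHS]add0r; apply: lerD.
  by rewrite mulr_ge0//; apply: sumr_ge0 => k _; rewrite -expr2 sqr_ge0.
by rewrite mulrA ler_wpM2r ?form_ge0// /conduct; case: ifP => _; lra.
Qed.

(* Both end points are compared with the average over a column of height [m] above the
   middle of a path joining them. *)
Lemma potential_oscillation phi g g' : connected_graph G -> (#|G| <= h)%N ->
  (phi g 0%N - phi g' 0%N) ^+ 2 <= (48 * harmonic R #|G| + 12) * energy phi phi.
Proof.
move=> Gc nh; have [p0 gp0 g'E] := connectP (Gc g g'); rewrite {}g'E.
case/shortenP: gp0 => p gp up _.
pose L := size p; pose P i := nth g (g :: p) i.
have Pinj i i' : (i <= L)%N -> (i' <= L)%N -> P i = P i' -> i = i'.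
  by move=> iL i'L /eqP; rewrite nth_uniq//= => /eqP.
have Padj i : (i < L)%N -> adj (P i) (P i.+1) by move/(pathP g): gp => /(_ i).
have PL : last g p = P L by rewrite /P /L -last_nth.
have Ln : (L < #|G|)%N by rewrite -[L.+1]/(size (g :: p)) -(card_uniqP up); exact: max_card.
pose m := L./2.
have mL : (m + m <= L <= (m + m).+1)%N by rewrite /m -[L in (_ <= L)%N]odd_double_half; lia.
have E0 : 0 <= energy phi phi.
  apply: sumr_ge0 => j _; apply: addr_ge0.
    by apply: sumr_ge0 => k _; rewrite -expr2 sqr_ge0.
  by rewrite mulr_ge0 ?form_ge0// ltW// conduct_gt0.
have H1 : (col_avg (phi (P m)) m - phi g 0%N) ^+ 2 <= 8 * harmonic R m * energy phi phi.
  apply: (@col_avg_path_le phi P m) => [|i i'|i im]; first by lia.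
    by move=> im i'm; apply: Pinj; lia.
  by apply: Padj; lia.
have H2 : (col_avg (phi (P (L - m)%N)) m - phi (P L) 0%N) ^+ 2 <= 8 * harmonic R m * energy phi phi.
  have := @col_avg_path_le phi (fun i => P (L - i)%N) m; rewrite subn0; apply.
  - by lia.
  - by move=> i i' im i'm /Pinj; lia.
  - move=> i im; rewrite adj_sym; have -> : (L - i = (L - i.+1).+1)%N by lia.
    by apply: Padj; lia.
have H3 : (col_avg (phi (P (L - m)%N)) m - col_avg (phi (P m)) m) ^+ 2 <= 4 * energy phi phi.
  have [->|Lm] := eqVneq (L - m)%N m; first by rewrite subrr expr0n mulr_ge0.
  have -> : (L - m = m.+1)%N by lia.
  by apply: col_avg_adj_le; [apply: Padj|]; lia.
have mH : harmonic R m <= harmonic R #|G|.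
  have mG : (m <= #|G|)%N by lia.
  rewrite /harmonic -!(big_mkord xpredT (fun i => i.+1%:R^-1)) (big_cat_nat _ mG)//= lerDl.
  by apply: sumr_ge0 => i _; rewrite invr_ge0.
have {}mH := ler_wpM2r E0 mH.
rewrite PL; move: H1 H2 H3 mH; set B := col_avg _ _; set A := col_avg _ _.
set x := phi g _; set y := phi _ _; set E := energy _ _; set K := harmonic _ _; set K' := harmonic _ _.
rewrite -!(mulrA 8) (_ : (48 * K' + 12) * E = 48 * (K' * E) + 12 * E); last by ring.
move: (K * E) (K' * E) => u v.
move=> H1 H2 H3 uv.
(* Three increments, squared at the price of a factor 3: 48 = 3 * (8 + 8) and 12 = 3 * 4. *)
have -> : (x - y) ^+ 2 = 3 * ((B - x) ^+ 2 + (A - y) ^+ 2 + (A - B) ^+ 2)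
  - ((B - x) + (A - y)) ^+ 2 - ((A - B) - (B - x)) ^+ 2 - ((A - B) + (A - y)) ^+ 2.
  by ring.
have := sqr_ge0 ((B - x) + (A - y)); have := sqr_ge0 ((A - B) - (B - x)).
have := sqr_ge0 ((A - B) + (A - y)); lra.
Qed.

End Potential.

(** * Estimates for the walk *)

Section Estimates.
Variables (G : sgraph) (R : realType).
Local Notation E := (cylinder G).
Implicit Types (x z : E) (g : G) (p : seq E).

Definition deg g : nat := #|[set g' | adj g g']%SET|.

Definition height (v : int) z : nat := absz (z.2 - v)%R.

Lemma height0 v z : height v z = 0%N -> z.2 = v.
Proof. by rewrite /height => /eqP; rewrite absz_eq0 subr_eq0 => /eqP. Qed.

Lemma avgE (f : E -> R) x : avg f x =
  (f (x.1, x.2 + 1) + f (x.1, x.2 - 1) + \sum_(g' : G | adj x.1 g') f (g', x.2)) /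
  (2 + (deg x.1)%:R).
Proof.
rewrite /avg /nbrs !big_cons big_map big_enum_cond /= size_map -cardE addrA.
congr (_ / _); last by rewrite -addn2 natrD addrC.
by congr (_ + _); apply: eq_bigl => g'; rewrite inE andbT.
Qed.

(** Link between the walk and the potential theory: seen through its base point and its distance to
    level [v], the walk has the reflected generator. *)
Lemma avg_height (v : int) (a : G -> nat -> R) x (j := height v x) :
  avg (fun z => a z.1 (height v z)) x = a x.1 j + lapl a x.1 j / (2 + (deg x.1)%:R).
Proof.
have d0 : 2 + (deg x.1)%:R != 0 :> R by rewrite gt_eqF// ltr_pwDl ?ler0n.
rewrite avgE /lapl.
rewrite -[X in (_ + X) / _ = _]/(\sum_(g' : G | adj x.1 g') a g' j).
rewrite -[X in (X + _) / _ = _]/(a x.1 (height v (x.1, x.2 + 1)) + a x.1 (height v (x.1, x.2 - 1))).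
have -> : a x.1 (height v (x.1, x.2 + 1)) + a x.1 (height v (x.1, x.2 - 1)) =
    a x.1 j.+1 + a x.1 (if j is j'.+1 then j' else 1%N).
  rewrite /j /height /=; case: x d0 j => g u /= _ _.
  have [uv|uv|uv] := ltgtP u v.
  - have -> : absz (u + 1 - v)%R = (if absz (u - v)%R is j'.+1 then j' else 1%N).
      by case E: (absz (u - v)%R) => [|k]; lia.
    have -> : absz (u - 1 - v)%R = (absz (u - v)%R).+1 by lia.
    by rewrite addrC.
  - have -> : absz (u - 1 - v)%R = (if absz (u - v)%R is j'.+1 then j' else 1%N).
      by case E: (absz (u - v)%R) => [|k]; lia.
    by have -> : absz (u + 1 - v)%R = (absz (u - v)%R).+1 by lia.
  - rewrite uv subrr /=.
    by have -> : absz (v + 1 - v)%R = 1%N; [lia|have -> : absz (v - 1 - v)%R = 1%N by lia].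
rewrite sumrB sumr_const -[a x.1 j *+ _]mulr_natl.
have -> : #|(fun g' => adj x.1 g')| = deg x.1 by rewrite /deg cardsE.
by field.
Qed.

Lemma deg_le (D : nat) g : (maxdeg G <= D)%N -> (deg g <= D)%N.
Proof. exact: leq_trans (card_nbrs_le g). Qed.

Lemma degD_le (D : nat) g : (maxdeg G <= D)%N -> (deg g)%:R <= D%:R :> R.
Proof. by move=> GD; rewrite ler_nat deg_le. Qed.

Lemma lapl_radial (a : nat -> R) g j :
  lapl (fun _ => a) g j = a j.+1 + a (if j is j'.+1 then j' else 1%N) - 2 * a j.
Proof. by rewrite /lapl big1 ?addr0// => g' _; rewrite subrr. Qed.

Lemma column_missed : (2 <= #|G|)%N ->
  exists g1 g2, forall N x,
    Ex N x (fun p => (has (fun z => z.1 == g1) p && has (fun z => z.1 == g2) p)%:R : R)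
      <= N%:R * spectral_gap G R.
Proof.
move=> n2; have [f [l [f0 [k0 fk0] /andP[l0 lgap] fl]]] := eigenfunction R n2.
have [g1 _ max1] : exists2 g1, true & forall g, f g <= f g1.
  by case: (@Order.TotalTheory.arg_maxP _ _ _ k0 xpredT f isT) => g1 _ H; exists g1 => // g; exact: H.
have [g2 _ min2] : exists2 g2, true & forall g, f g2 <= f g.
  by case: (@Order.TotalTheory.arg_minP _ _ _ k0 xpredT f isT) => g2 _ H; exists g2 => // g; exact: H.
have n0 := card_vertex_gt0 G R.
(* A mean-zero function satisfies [f g2 <= 0 <= f g1]; hence [f] is bounded by [w] in absolute
   value, on which [drift] rests. *)
have M0 : 0 <= f g1.
  rewrite leNgt; apply/negP => M0; move: f0; apply/eqP; rewrite lt_eqF//.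
  rewrite (bigD1 k0)//=; apply: ltr_wnDr; last exact: le_lt_trans (max1 _) M0.
  by apply: sumr_le0 => g _; apply: ltW; exact: le_lt_trans (max1 _) M0.
have m0 : f g2 <= 0.
  rewrite leNgt; apply/negP => m0; move: f0; apply/eqP; rewrite gt_eqF//.
  rewrite (bigD1 k0)//=; apply: ltr_wpDr; last exact: lt_le_trans m0 (min2 _).
  by apply: sumr_ge0 => g _; apply: ltW; exact: lt_le_trans m0 (min2 _).
have Mm : 0 < f g1 - f g2.
  have := max1 k0; have := min2 k0; rewrite subr_gt0 lt_neqAle => h1 h2.
  rewrite (le_trans h1 h2) andbT; apply: contra fk0 => /eqP E.
  by rewrite eq_le; apply/andP; split; [apply: le_trans h2 _; rewrite -E|apply: le_trans h1; rewrite E].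
set w := f g1 - f g2 in Mm.
have g12 : g1 != g2 by apply: contraTneq Mm => E; rewrite /w E subrr ltxx.
exists g1, g2 => N x.
pose upd (s : bool * bool) (z : E) := (s.1 || (z.1 == g1), s.2 || (z.1 == g2)).
(* Once [g1] has been visited, (f g1 - f z) / w starts from 0, equals 1 at [g2] and drifts by at
   most [l] per step; symmetrically after [g2]. The term [k%:R * l] collects the drifts to come. *)
pose Phi (k : nat) (s : bool * bool) (z : E) : R :=
  match s with
  | (true, true) => 1
  | (true, false) => (f g1 - f z.1) / w + k%:R * l
  | (false, true) => (f z.1 - f g2) / w + k%:R * l
  | (false, false) => k%:R * l
  end.
have updE p : foldl upd (false, false) p =
    (has (fun z => z.1 == g1) p, has (fun z => z.1 == g2) p).
  suff H b1 b2 : foldl upd (b1, b2) p =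
    (b1 || has (fun z => z.1 == g1) p, b2 || has (fun z => z.1 == g2) p) by exact: H.
  by elim: p b1 b2 => [|z p IH] b1 b2 /=; rewrite ?orbF// /upd /= IH !orbA.
have kl k : 0 <= k%:R * l by rewrite mulr_ge0.
have avgf z : avg (fun z => f z.1) z = f z.1 - l * f z.1 / (2 + (deg z.1)%:R).
  have := avg_height 0 (fun g _ => f g) z; rewrite /= => ->.
  rewrite /lapl (_ : f z.1 + f z.1 - 2 * f z.1 = 0); last by ring.
  by rewrite add0r fl mulNr mulNr.
have drift z : `|l * f z.1 / (2 + (deg z.1)%:R) / w| <= l.
  rewrite !normrM [`|l|]ger0_norm// -!mulrA -[leRHS]mulr1 ler_wpM2l//.
  have d0 : 1 <= 2 + (deg z.1)%:R :> R by have := ler0n R (deg z.1); lra.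
  have fw : `|f z.1| <= w.
    by rewrite ler_norml /w; have := max1 z.1; have := min2 z.1; lra.
  rewrite !normfV (ger0_norm (le_trans ler01 d0)) (gtr0_norm Mm) mulrCA.
  have d1 : 0 < 2 + (deg z.1)%:R :> R by apply: lt_le_trans d0.
  rewrite -[leRHS]mulr1; apply: ler_pM.
  - by rewrite invr_ge0 ltW.
  - by rewrite divr_ge0// ltW.
  - by rewrite invf_le1.
  - by rewrite ler_pdivrMr// mul1r.
have step k s z : avg (fun y => Phi k (upd s y) y) z <= Phi k.+1 s z.
  have kS : k.+1%:R * l = k%:R * l + l by rewrite -natr1; ring.
  have := drift z; rewrite ler_norml => /andP[dr1 dr2].
  case: s => -[] [] /=.
  - by rewrite avg_cst.
  - apply: le_trans (_ : avg (fun y => (f g1 / w + k%:R * l) + (- w^-1) * f y.1) z <= _).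
      apply: ler_avg => y _; rewrite /Phi /upd /=; case: eqP => [->|_].
        have -> : f g1 / w + k%:R * l + - w^-1 * f g2 = (f g1 - f g2) / w + k%:R * l by ring.
        by rewrite -/w mulfV ?gt_eqF// lerDl.
      by rewrite le_eqVlt; apply/orP; left; apply/eqP; ring.
    rewrite avgD avg_cst avgZ avgf kS.
    move: dr1 dr2; rewrite -/w; set t := l * f z.1 / _ => dr1 dr2.
    have -> : f g1 / w + k%:R * l + - w^-1 * (f z.1 - t) = (f g1 - f z.1) / w + k%:R * l + t / w by ring.
    lra.
  - apply: le_trans (_ : avg (fun y => (- f g2 / w + k%:R * l) + w^-1 * f y.1) z <= _).
      apply: ler_avg => y _; rewrite /Phi /upd /=; case: eqP => [->|_].
        have -> : - f g2 / w + k%:R * l + w^-1 * f g1 = (f g1 - f g2) / w + k%:R * l by ring.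
        by rewrite -/w mulfV ?gt_eqF// lerDl.
      by rewrite le_eqVlt; apply/orP; left; apply/eqP; ring.
    rewrite avgD avg_cst avgZ avgf kS.
    move: dr1 dr2; rewrite -/w; set t := l * f z.1 / _ => dr1 dr2.
    have -> : - f g2 / w + k%:R * l + w^-1 * (f z.1 - t) = (f z.1 - f g2) / w + k%:R * l - t / w by ring.
    lra.
  - apply: le_trans (_ : avg (fun=> k%:R * l) z <= _); last by rewrite avg_cst kS lerDl.
    apply: ler_avg => y _; rewrite /Phi /upd /=.
    case: eqP => [->|_]; first by rewrite (negbTE g12) subrr mul0r add0r.
    by case: eqP => [->|_]; rewrite ?subrr ?mul0r ?add0r.
apply: le_trans (_ : Phi N (upd (false, false) x) x <= _); last first.
  have Nl : N%:R * l <= N%:R * spectral_gap G R by rewrite ler_wpM2l.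
  rewrite /Phi /upd /=.
  case: eqP => [->|_]; first by rewrite (negbTE g12) subrr mul0r add0r.
  by case: eqP => [->|_]; rewrite ?subrr ?mul0r ?add0r.
apply: (@Ex_automaton _ _ _ upd (fun _ _ => True)) => // p y _.
rewrite updE /Phi mul0r !addr0.
case: (has _ _); case: (has _ _) => //=.
- by rewrite divr_ge0 ?(ltW Mm)// subr_ge0.
- by rewrite divr_ge0 ?(ltW Mm)// subr_ge0.
Qed.

(** Exponential moment of the number of visits: in average, 1 + q^height with q = 1 - b shrinks at
    least by the factor [alpha] at level [v], which pays for a weight [alpha^-1] per visit, and
    grows at most by 1 + b^2 per step elsewhere. With b of order N^(-1/2) the visits beyond order
    N^(1/2) become unlikely. *)
Lemma level_visits (N m D : nat) (b : R) (v : int) x : (maxdeg G <= D)%N ->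
  0 < b <= 1 ->
  Ex N x (fun p => (m < count (fun z => z.2 == v) p)%N%:R) <=
    (1 - b / (2 + D%:R)) ^+ m * (2 * (1 + b ^+ 2) ^+ N).
Proof.
move=> GD /andP[b0 b1]; set alpha := 1 - _.
have D2 : 2 <= 2 + D%:R :> R by rewrite lerDl ler0n.
have D0 : 0 < 2 + D%:R :> R by apply: lt_le_trans D2.
have bD : b / (2 + D%:R) <= 2^-1.
  by rewrite ler_pdivrMr// ; lra.
have bD0 : 0 < b / (2 + D%:R) by rewrite divr_gt0.
have a2 : 2^-1 <= alpha by rewrite /alpha; lra.
have a1 : alpha <= 1 by rewrite /alpha; lra.
have a0 : 0 < alpha by apply: lt_le_trans a2; rewrite invr_gt0.
pose q := 1 - b.
have q0 : 0 <= q by rewrite /q; lra.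
have q1 : q <= 1 by rewrite /q; lra.
(* The factor [alpha] at [v] offsets the weight of the visit that [upd] has just counted; elsewhere
   the summand 1 lets a factor 1 + b^2 absorb the additive error. *)
pose psi (z : E) : R := if z.2 == v then 2 * alpha else 1 + q ^+ height v z.
pose upd (c : nat) (z : E) := (c + (z.2 == v))%N.
pose Phi (k c : nat) (z : E) : R :=
  alpha ^+ m * (alpha^-1 ^+ c * psi z * (1 + b ^+ 2) ^+ k).
have updE p c : foldl upd c p = (c + count (fun z => z.2 == v) p)%N.
  by elim: p c => [|z p IH] c /=; rewrite ?addn0// IH /upd addnA.
have b2 : 1 <= 1 + b ^+ 2 by rewrite lerDl sqr_ge0.
have psiE c z : alpha^-1 ^+ upd c z * psi z = alpha^-1 ^+ c * (1 + q ^+ height v z).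
  rewrite /upd exprD -mulrA; congr (_ * _); rewrite /psi; case: eqP => zv.
    by rewrite expr1 /height zv subrr expr0 mulrCA mulVf ?mulr1 ?gt_eqF//.
  by rewrite expr0 mul1r.
have step k c z : True -> avg (fun y => Phi k (upd c y) y) z <= Phi k.+1 c z.
  move=> _; rewrite /Phi avgZ ler_wpM2l ?exprn_ge0 ?(ltW a0)//.
  rewrite (eq_avg (h' := fun y => alpha^-1 ^+ c * (1 + b ^+ 2) ^+ k * (1 + q ^+ height v y))); last first.
    by move=> y _; rewrite psiE mulrAC.
  rewrite avgZ.
  have -> : alpha^-1 ^+ c * psi z * (1 + b ^+ 2) ^+ k.+1 =
      alpha^-1 ^+ c * (1 + b ^+ 2) ^+ k * ((1 + b ^+ 2) * psi z).
    by rewrite exprS; move: (alpha^-1 ^+ c) ((1 + b ^+ 2) ^+ k) => *; ring.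
  have c0 : 0 <= alpha^-1 ^+ c * (1 + b ^+ 2) ^+ k.
    by rewrite mulr_ge0 ?exprn_ge0 ?invr_ge0 ?(ltW a0)// (le_trans ler01).
  rewrite ler_wpM2l//.
  have := avg_height v (fun _ j => 1 + q ^+ j) z; rewrite /= => ->.
  rewrite lapl_radial /psi.
  have dD := degD_le z.1 GD.
  have d2 : 2 <= 2 + (deg z.1)%:R :> R by rewrite lerDl ler0n.
  have d0 : 0 < 2 + (deg z.1)%:R :> R by apply: lt_le_trans d2.
  case: eqP => zv.
    rewrite /height zv subrr expr0 expr1.
    have -> : 1 + q + (1 + q) - 2 * (1 + 1) = - (2 * b) by rewrite /q; ring.
    apply: le_trans (_ : 2 * alpha <= _); last by rewrite ler_peMl// mulr_ge0// ltW.
    rewrite mulNr.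
    have : 2 * b / (2 + D%:R) <= 2 * b / (2 + (deg z.1)%:R).
      rewrite ler_wpM2l ?mulr_ge0 ?(ltW b0)// lef_pV2 ?posrE//; lra.
    by rewrite -mulrA /alpha; lra.
  case E : (height v z) => [|j]; first by case: zv; apply: height0; rewrite E.
  have -> : 1 + q ^+ j.+2 + (1 + q ^+ j) - 2 * (1 + q ^+ j.+1) = q ^+ j * b ^+ 2.
    by rewrite !exprS /q; move: (_ ^+ j) => t; ring.
  have qj : q ^+ j * b ^+ 2 / (2 + (deg z.1)%:R) <= b ^+ 2.
    rewrite ler_pdivrMr// [leRHS]mulrC ler_wpM2r ?sqr_ge0//.
    by apply: le_trans (exprn_ile1 _ q0 q1) _; lra.
  rewrite mulrDl mul1r lerD2l; apply: le_trans qj _.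
  by rewrite ler_peMr ?sqr_ge0// lerDl exprn_ge0.
have psi1 z : 1 <= psi z.
  by rewrite /psi; case: ifP => _; [lra|rewrite lerDl exprn_ge0].
apply: le_trans (_ : Phi N (upd 0%N x) x <= _); last first.
  rewrite /Phi psiE expr0 mul1r ler_wpM2l ?exprn_ge0 ?(ltW a0)//.
  rewrite ler_wpM2r ?exprn_ge0 ?(le_trans ler01)//.
  by rewrite -[2]/(1 + 1) lerD2l exprn_ile1.
apply: (@Ex_automaton _ _ _ upd (fun _ _ => True)) => // p y _.
rewrite updE add0n /Phi expr0 mulr1; set c := count _ _.
case: ltnP => mc; last first.
  by rewrite mulr_ge0 ?exprn_ge0 ?(ltW a0)// mulr_ge0 ?exprn_ge0 ?invr_ge0 ?(ltW a0)// (le_trans ler01).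
rewrite mulrA -[leLHS]mulr1; apply: ler_pM => //.
rewrite -(subnKC (ltnW mc)) exprD mulrA exprVn mulfV ?gt_eqF ?exprn_gt0// mul1r.
by rewrite exprn_ege1// invf_ge1.
Qed.

Lemma bernoulli (y : R) n : -1 <= y -> 1 + n%:R * y <= (1 + y) ^+ n.
Proof.
move=> y1; elim: n => [|n IH]; first by rewrite mul0r addr0 expr0.
rewrite exprS; apply: le_trans (_ : (1 + y) * (1 + n%:R * y) <= _).
  have := mulr_ge0 (ler0n R n) (sqr_ge0 y); rewrite -natr1.
  have -> : (1 + y) * (1 + n%:R * y) = 1 + (n%:R + 1) * y + n%:R * y ^+ 2 by ring.
  lra.
by rewrite ler_wpM2l//; lra.
Qed.

(** * Rounds between a level and height [h] *)

Section Rounds.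
Variables (D h k : nat) (u0 : int) (b : R).
Hypothesis GD : (maxdeg G <= D)%N.
Hypothesis h0 : (0 < h)%N.

(* The first component tells whether the walk is on its way out to height [h] or back
   to level [u0]; the second one counts the completed ways out. *)
Definition round_step (s : bool * nat) (z : E) : bool * nat :=
  if s.1 then if (h <= height u0 z)%N then (false, s.2.+1) else s
  else if height u0 z == 0%N then (true, s.2) else s.

Definition rounds p : nat := (foldl round_step (false, 0%N) p).2.

Definition round_inv (s : bool * nat) (z : E) : Prop :=
  if s.1 then (height u0 z < h)%N else (0 < height u0 z)%N.

Lemma height_nbrs z y : y \in nbrs z -> (height u0 y <= (height u0 z).+1)%N.
Proof.
rewrite mem_nbrs /adjE /height => /orP[/andP[_]|/andP[/eqP ->]]; last by lia.
lia.
Qed.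

Lemma round_inv_step s z y : round_inv s z -> y \in nbrs z -> round_inv (round_step s y) y.
Proof.
move=> _ _; rewrite /round_inv /round_step; case: s => -[] j /=.
  by case: leqP => hy //=; exact: leq_trans h0 hy.
by case: eqP => [->|]//=; lia.
Qed.

Lemma round_inv0 x : height u0 x = 0%N -> round_inv (round_step (false, 0%N) x) x.
Proof. by move=> x0; rewrite /round_inv /round_step /= x0. Qed.

(** Laplace transform of the time needed for [k] rounds: [q ^+ rem] is at most 1 and in average
    gains a factor [rho] per step as long as rounds remain, so its initial value is at most the
    probability of finishing by time [N] plus [rho ^- N]. *)
Lemma few_rounds N x : 0 < b < 1 -> height u0 x = 0%N -> (0 < k)%N ->
  Ex N x (fun p => (rounds p < k)%N%:R) <=
    (2 * k * h)%:R * b + (1 + N%:R * (b ^+ 2 / (2 + D%:R)))^-1.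
Proof.
move=> /andP[b0 b1] x0 k0.
have D0 : 0 < 2 + D%:R :> R by rewrite ltr_pwDl ?ler0n.
pose q := 1 - b; pose rho := 1 + b ^+ 2 / (2 + D%:R).
have q0 : 0 < q by rewrite /q; lra.
have q1 : q <= 1 by rewrite /q; lra.
have rho1 : 1 <= rho by rewrite lerDl divr_ge0 ?sqr_ge0 ?ltW.
have rho0 : 0 < rho by apply: lt_le_trans rho1.
(* The vertical distance left before the last way out is completed, with [2 * h] for each further
   round. *)
pose rem (s : bool * nat) (v : nat) : nat :=
  ((k.-1 - s.2) * (2 * h) + (if s.1 then h - v else v + h))%N.
pose w (s : bool * nat) (z : E) : R := if (k <= s.2)%N then 1 else q ^+ rem s (height u0 z).
pose Phi (t : nat) (s : bool * nat) (z : E) : R :=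
  if (k <= s.2)%N then 0 else Num.min 1 (1 - w s z + rho ^- t).
have rt t : 0 < rho ^- t by rewrite invr_gt0 exprn_gt0.
have w01 s z : 0 <= w s z <= 1.
  by rewrite /w; case: ifP => _; rewrite ?ler01 ?lexx// exprn_ge0 ?exprn_ile1 ?(ltW q0).
have Phi_ge0 t s z : 0 <= Phi t s z.
  rewrite /Phi; case: ifP => // _; rewrite le_min ler01 /=.
  by have := w01 s z; have := rt t; lra.
have step t s z : round_inv s z -> avg (fun y => Phi t (round_step s y) y) z <= Phi t.+1 s z.
  move=> inv; rewrite {2}/Phi; case: leqP => ks.
    rewrite (eq_avg (h' := fun=> 0)) ?avg_cst// => y _.
    by rewrite /Phi (leq_trans ks)// /round_step; case: s {inv ks} => -[] j /=; case: ifP.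
  pose W (y : E) : R := q ^+ rem s (height u0 y).
  have PW y : y \in nbrs z -> Phi t (round_step s y) y <= Num.min 1 (1 - W y + rho ^- t).
    move=> /height_nbrs zy; rewrite {1}/Phi.
    have W1 : W y <= 1 by rewrite exprn_ile1// ltW.
    case: leqP => ks'.
      by rewrite le_min ler01 /=; have := rt t; lra.
    suff -> : w (round_step s y) y = W y by [].
    rewrite /w leqNgt ks' /=; congr (_ ^+ _).
    rewrite /W /rem; move: inv ks ks'; rewrite /round_inv /round_step.
    case: s {W W1} => -[] j /= inv ks; case: ifP => /= hy ks' //.
      have -> : height u0 y = h by lia.
      have -> : (k.-1 - j = (k.-1 - j.+1).+1)%N by lia.
      by rewrite mulSn; set t' := (_ * (2 * h))%N; lia.
    by rewrite (eqP hy) subn0.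
  have [e remE lE] : exists2 e, rem s (height u0 z) = e.+1 &
      q ^+ e * b ^+ 2 <= lapl (fun _ v => q ^+ rem s v) z.1 (height u0 z).
    have lapE e : q ^+ e.+2 + q ^+ e - 2 * q ^+ e.+1 = q ^+ e * b ^+ 2.
      by rewrite !exprS /q; move: (_ ^+ e) => y; ring.
    move: inv; rewrite /round_inv lapl_radial /rem; case: s {PW W ks} => -[] j /=.
      set c := (_ * _)%N; move=> vh; exists (c + (h - (height u0 z).+1))%N; first by lia.
      move: vh; case: (height u0 z) => [|v] vh.
        (* At height 0 both vertical neighbours are closer to [h], so the second difference is of
           first order in [b], larger than the required [b ^+ 2]. *)
        have -> : (c + (h - 0) = (c + (h - 1)).+1)%N by lia.
        rewrite (exprS q); have qe : 0 <= q ^+ (c + (h - 1)) by rewrite exprn_ge0 ?(ltW q0).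
        have -> : forall y : R, y + y - 2 * (q * y) = y * (2 * b) by move=> y; rewrite /q; ring.
        by rewrite ler_wpM2l// expr2 ler_wpM2r ?(ltW b0)//; lra.
      have -> : (c + (h - v) = (c + (h - v.+2)).+2)%N by lia.
      have -> : (c + (h - v.+1) = (c + (h - v.+2)).+1)%N by lia.
      by rewrite -lapE [X in _ <= X - _]addrC.
    set c := (_ * _)%N; case: (height u0 z) => [//|v] _; exists (c + (v + h))%N; first by lia.
    by rewrite !addSn !addnS lapE.
  have Wavg : rho * W z <= avg W z.
    have := avg_height u0 (fun _ v => q ^+ rem s v) z; rewrite /= -/(W z) => ->.
    rewrite /rho mulrDl mul1r lerD2l.
    have dD := degD_le z.1 GD.
    have d0 : 0 < 2 + (deg z.1)%:R :> R by rewrite ltr_pwDl ?ler0n.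
    apply: le_trans (_ : q ^+ e * b ^+ 2 / (2 + (deg z.1)%:R) <= _); last first.
      by rewrite ler_wpM2r// invr_ge0 ltW.
    have -> : b ^+ 2 / (2 + D%:R) * W z = (W z * b ^+ 2) / (2 + D%:R) by ring.
    have qe : 0 <= q ^+ e by rewrite exprn_ge0 ?(ltW q0).
    have We : W z <= q ^+ e by rewrite /W remE exprS ler_piMl.
    apply: ler_pM; rewrite ?mulr_ge0 ?exprn_ge0 ?invr_ge0 ?(ltW q0) ?(ltW D0) ?(ltW b0)//.
      by rewrite ler_wpM2r ?sqr_ge0.
    by rewrite lef_pV2 ?posrE//; lra.
  have -> : w s z = W z by rewrite /w leqNgt ks.
  have min1 : avg (fun y => Phi t (round_step s y) y) z <= 1.
    rewrite -(avg_cst 1 z); apply: ler_avg => y /PW /le_trans; apply.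
    by rewrite ge_min lexx.
  rewrite le_min min1 /=.
  (* Below [rho ^- t.+1] the trivial bound 1 suffices; above it, the average gain of [W] outweighs
     the growth of [rho ^- t] when one step less remains. *)
  have [lo|hi] := ltP (W z) (rho ^- t.+1); first by apply: le_trans min1 _; lra.
  apply: le_trans (_ : avg (fun y => 1 + rho ^- t + (- 1) * W y) z <= _).
    apply: ler_avg => y /PW /le_trans; apply.
    by rewrite ge_min; apply/orP; right; lra.
  rewrite avgD avg_cst avgZ.
  have rS : rho ^- t = rho * rho ^- t.+1 by rewrite exprS invfM mulVKf// gt_eqF.
  have : (rho - 1) * (W z - rho ^- t.+1) >= 0 by rewrite mulr_ge0// subr_ge0.
  rewrite rS mulrBr !mulrBl !mul1r; lra.
apply: le_trans (_ : Phi N (round_step (false, 0%N) x) x <= _); last first.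
  rewrite /round_step /= x0 /Phi /= leqNgt k0 /= ge_min; apply/orP; right.
  rewrite addrC [leRHS]addrC; apply: lerD.
    rewrite lef_pV2 ?posrE ?exprn_gt0//; last first.
      by rewrite ltr_pwDl// mulr_ge0// divr_ge0 ?sqr_ge0 ?ltW.
    by apply: bernoulli; have := rho1; rewrite /rho; lra.
  rewrite /w leqNgt k0 /=; set n := rem _ _.
  have nk : (n <= 2 * k * h)%N.
    rewrite /n /rem /= x0 subn0; move: k0; case: k => // k' _ /=; nia.
  have := @bernoulli (- b) n; rewrite -/q => /(_ _) bn.
  have {}bn : 1 + n%:R * - b <= q ^+ n by apply: bn; lra.
  have : n%:R * b <= (2 * k * h)%:R * b by rewrite ler_wpM2r ?ler_nat// ltW.
  by move: bn; rewrite mulrN; lra.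
apply: (Ex_automaton round_inv_step step); first exact: round_inv0.
move=> p y _; rewrite -/(rounds _) /Phi /rounds; case: leqP => //= _.
rewrite le_min lexx /= expr0 invr1; have := w01 (foldl round_step (false, 0%N) (rcons p y)) y; lra.
Qed.

(* [phi] is a subharmonic minorant, up to height [h], of the probability of visiting
   [(g0, u0)] before reaching height [h], so that each round misses [(g0, u0)] with
   probability at most 1/2. *)
Lemma rounds_missing (phi : G -> nat -> R) g0 N x :
  admissible h g0 phi ->
  (forall g j, (j < h)%N -> (g, j) != (g0, 0%N) -> 0 <= lapl phi g j) ->
  (forall g, 2^-1 <= phi g 0%N) -> height u0 x = 0%N -> (0 < k)%N ->
  Ex N x (fun p => (((g0, u0) \notin p) && (k <= rounds p)%N)%:R : R) <= 2^-1 ^+ k.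
Proof.
move=> [p01 ph pg] sub phalf x0 k0.
pose y0 : E := (g0, u0).
pose r (z : E) : R := 1 - phi z.1 (height u0 z).
pose upd (s : bool * nat * bool) (z : E) := (round_step s.1 z, s.2 || (z == y0)).
(* On a way out, [2 * r z] starts at level [u0] from at most 1, does not increase in average, and
   equals 2 at height [h], exactly when the exponent [k - s.1.2] drops by one: each completed way
   out costs a factor 1/2. *)
pose Phi (t : nat) (s : bool * nat * bool) (z : E) : R :=
  if s.2 then 0 else if (k <= s.1.2)%N then 1 else
  2^-1 ^+ (k - s.1.2) * (if s.1.1 then 2 * r z else 1).
pose Inv (s : bool * nat * bool) (z : E) := round_inv s.1 z /\ (s.2 = false -> z != y0).
have r01 z : 0 <= r z <= 1 by rewrite /r; have := p01 z.1 (height u0 z); lra.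
have r_half z : height u0 z = 0%N -> r z <= 2^-1.
  by rewrite /r => ->; have := phalf z.1; lra.
have r_out z : (h <= height u0 z)%N -> r z = 1.
  by move=> hz; rewrite /r ph// subr0.
have r_super z : (height u0 z < h)%N -> z != y0 -> avg r z <= r z.
  move=> zh zy; rewrite /r avgD avgN avg_cst avg_height opprD addrA gerBl.
  apply: divr_ge0; last by rewrite addr_ge0 ?ler0n.
  apply: sub => //.
  apply: contra zy => /eqP[zg z0].
  by rewrite (surjective_pairing z) zg (height0 z0).
have p0 n : 0 <= 2^-1 ^+ n :> R by rewrite exprn_ge0 ?invr_ge0.
have p1 n : 2^-1 ^+ n <= 1 :> R by rewrite exprn_ile1 ?invr_ge0 ?invf_le1 ?ler1n.
have updE p s : foldl upd s p = (foldl round_step s.1 p, s.2 || (y0 \in p)).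
  elim: p s => [|z p IH] s /=; first by rewrite orbF -surjective_pairing.
  by rewrite IH /upd /= inE (eq_sym y0) orbA.
have invS s z y : Inv s z -> y \in nbrs z -> Inv (upd s y) y.
  by move=> [i1 _] yz; split=> [|/=]; [exact: round_inv_step i1 yz|case: s.2 => //= ->].
have step t s z : Inv s z -> avg (fun y => Phi t (upd s y) y) z <= Phi t.+1 s z.
  case: s => -[ps j] vis [/= inv /= zy]; rewrite {2}/Phi /=.
  case: vis zy => zy.
    by rewrite (eq_avg (h' := fun=> 0)) ?avg_cst// => y _; rewrite /Phi /upd /=.
  have {}zy := zy erefl.
  case: leqP => jk.
    rewrite -(avg_cst 1 z); apply: ler_avg => y _; rewrite /Phi /upd /=.
    case: ifP => // _; rewrite ifT// /round_step /=.
    by case: ps {inv} => /=; case: ifP => //= _; exact: leq_trans jk _.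
  have kj : (k - j = (k - j.+1).+1)%N by lia.
  have jk0 : (k <= j)%N = false by rewrite leqNgt jk.
  case: ps inv => /= inv.
    apply: le_trans (_ : avg (fun y => 2^-1 ^+ (k - j) * 2 * r y) z <= _).
      apply: ler_avg => y _; rewrite /Phi /upd /=; have /andP[r0 r1] := r01 y.
      case: ifP => _; first by rewrite !mulr_ge0.
      rewrite /round_step /=; case: (leqP h (height u0 y)) => /= hy; last by rewrite jk0 mulrA.
      have -> : 2^-1 ^+ (k - j) * 2 * r y = 2^-1 ^+ (k - j.+1).
        by rewrite r_out// kj exprS mulr1 mulrAC mulVf ?mul1r.
      by case: leqP => jk'; [rewrite (eqP jk') expr0|rewrite mulr1].
    by rewrite avgZ -mulrA ler_wpM2l// ler_wpM2l// r_super.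
  rewrite mulr1 -(avg_cst (2^-1 ^+ (k - j)) z); apply: ler_avg => y _.
  rewrite /Phi /upd /=; case: ifP => // _.
  rewrite /round_step /=; case: (eqVneq (height u0 y) 0%N) => hy /=; rewrite jk0 ?mulr1//.
  by rewrite ler_piMr//; have := r_half _ hy; lra.
apply: le_trans (_ : Phi N (upd (false, 0%N, false) x) x <= _); last first.
  rewrite /Phi /upd /round_step /= x0 /= leqNgt k0 /= subn0.
  by case: ifP => // _; rewrite ler_piMr//; have := r_half _ x0; lra.
apply: (Ex_automaton invS step).
  split; first exact: round_inv0.
  by rewrite /upd /= => /negbT.
move=> p y _; rewrite updE /Phi /= -/(rounds _).
case: (boolP (y0 \in rcons p y)) => _ //=.
case: leqP => //= _; rewrite mulr_ge0//; case: ifP => // _.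
by have := r01 y; lra.
Qed.

End Rounds.
End Estimates.

(** * Disconnection events *)

Section Events.
Variables (G : sgraph) (R : realType).
Local Notation E := (cylinder G).
Implicit Types (X : nat -> E) (x z : E) (p : seq E) (n N : nat).

Lemma disconnection_time_ge X N (t : R) :
  (forall n, (n <= N)%N -> ~ disconnects (X @` `I_n.+1)) -> t <= N.+1%:R ->
  (t%:E <= disconnection_time X)%E.
Proof.
move=> Xn tN; apply: le_ereal_inf_tmp => _ [n /= Xd <-].
rewrite lee_fin (le_trans tN)// ler_nat ltnNge; apply/negP => /Xn; exact.
Qed.

Lemma disconnection_time_le X N (t : R) :
  disconnects (X @` `I_N.+1) -> N%:R <= t -> (disconnection_time X <= t%:E)%E.
Proof.
move=> Xd Nt; apply: (@le_trans _ _ (N%:R%:E)); last by rewrite lee_fin.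
by apply: ereal_inf_lbound; exists N.
Qed.

Lemma disconnection_timeP X (t : R) : 0 <= t ->
  (disconnection_time X <= t%:E)%E <-> exists2 n, n%:R <= t & disconnects (X @` `I_n.+1).
Proof.
move=> t0; split=> [Xt|[n nt Xn]]; last exact: disconnection_time_le Xn nt.
apply: contrapT => Xd.
have : ((Num.truncn t).+1%:R%:E <= disconnection_time X :> \bar R)%E.
  apply: (@disconnection_time_ge _ (Num.truncn t)) => // n nt Xn.
  by apply: Xd; exists n => //; rewrite -truncn_ge_nat.
move=> /le_trans/(_ Xt); rewrite lee_fin leNgt.
by have /andP[_ ->] := truncn_itv t0.
Qed.

Lemma prefix_image X Y N n : (n <= N)%N -> (forall i, (i <= N)%N -> X i = Y i) ->
  X @` `I_n.+1 = Y @` `I_n.+1.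
Proof.
move=> nN XY; apply/seteqP; split=> z [i /= iN <-]; exists i => //.
  by rewrite XY// (leq_trans _ nN).
by rewrite XY// (leq_trans _ nN).
Qed.

(** The infimum is over integers, so both inequalities become countable combinations of events that
    depend on a finite prefix. *)
Lemma measurable_disconnection_event (lo up : R) : 0 <= up ->
  measurable ([set X | (lo%:E <= disconnection_time X <= up%:E)%E] : set (trajectory G)).
Proof.
move=> up0.
pose A n : set (trajectory G) := [set X | disconnects (X @` `I_n.+1) -> lo <= n%:R].
pose B n : set (trajectory G) := [set X | n%:R <= up /\ disconnects (X @` `I_n.+1)].
have -> : [set X : nat -> E | (lo%:E <= disconnection_time X <= up%:E)%E] =
    (\bigcap_n A n) `&` (\bigcup_n B n).
  apply/seteqP; split=> X /=.
    move=> /andP[lX /disconnection_timeP[]// n nu Xn]; split; last by exists n.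
    move=> m _ Xm; rewrite -lee_fin; apply: le_trans lX _.
    exact: disconnection_time_le Xm (lexx _).
  move=> [XA [n _ [nu Xn]]]; apply/andP; split; last exact: disconnection_time_le Xn nu.
  by apply: le_ereal_inf_tmp => _ [m Xm <-]; rewrite lee_fin; exact: XA.
apply: measurableI.
  apply: bigcapT_measurable => n; apply: (@measurable_prefix _ n) => X Y XY.
  by rewrite /A /= (prefix_image (leqnn n) XY).
apply: bigcupT_measurable => n; apply: (@measurable_prefix _ n) => X Y XY.
by rewrite /B /= (prefix_image (leqnn n) XY).
Qed.

Lemma measurable_mkseq N (Q : pred (seq E)) :
  measurable ([set X | Q (mkseq X N.+1)] : set (trajectory G)).
Proof.
apply: (@measurable_prefix _ N) => X Y XY /=.
suff -> : mkseq X N.+1 = mkseq Y N.+1 by [].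
by apply/eq_in_map => i; rewrite mem_iota => /andP[_ iN]; rewrite XY.
Qed.

(** Each tail has its own horizon and its own bad event on prefixes; a union bound joins them. *)
Lemma disconnection_prob_ge x (lo up e1 e2 : R) N1 N2 (Q1 Q2 : pred (seq E)) :
  0 <= up ->
  (forall X, ~~ Q1 (mkseq X N1.+1) -> (lo%:E <= disconnection_time X)%E) ->
  (forall X, ~~ Q2 (mkseq X N2.+1) -> (disconnection_time X <= up%:E)%E) ->
  Ex N1 x (fun p => (Q1 p)%:R) <= e1 -> Ex N2 x (fun p => (Q2 p)%:R) <= e2 ->
  ((1 - (e1 + e2))%:E <=
    srw_law R x [set X | (lo%:E <= disconnection_time X <= up%:E)%E])%E.
Proof.
move=> up0 XQ1 XQ2 Qe1 Qe2; set P := srw_law R x.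
pose A1 : set (trajectory G) := [set X | Q1 (mkseq X N1.+1)].
pose A2 : set (trajectory G) := [set X | Q2 (mkseq X N2.+1)].
have mA1 : measurable A1 by exact: measurable_mkseq.
have mA2 : measurable A2 by exact: measurable_mkseq.
have mA : measurable (A1 `|` A2) by exact: measurableU.
have PA : (P (A1 `|` A2) <= (e1 + e2)%:E)%E.
  apply: le_trans (measureU2 _ mA1 mA2) _; rewrite EFinD; apply: leeD.
    by apply: le_trans (law_le_Ex R x N1 Q1) _; rewrite lee_fin.
  by apply: le_trans (law_le_Ex R x N2 Q2) _; rewrite lee_fin.
apply: (@le_trans _ _ (P (~` (A1 `|` A2)))).
  by rewrite probability_setC// EFinB; apply: leeB.
apply: le_measure; rewrite ?inE; [exact: measurableC|exact: measurable_disconnection_event|].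
move=> X /=; rewrite not_orE => -[/negP n1 /negP n2].
by rewrite XQ1//= XQ2.
Qed.

Lemma mem_mkseq_image X N z : z \in mkseq X N.+1 <-> (X @` `I_N.+1) z.
Proof.
split=> [/mapP[i]|[i /= iN <-]]; first by rewrite mem_iota => /andP[_ iN] ->; exists i.
by apply/mapP; exists i; rewrite // mem_iota.
Qed.

Lemma image_sub X N n z : (n <= N)%N -> (X @` `I_n.+1) z -> z \in mkseq X N.+1.
Proof.
move=> nN [i /= iN <-]; apply/mem_mkseq_image; exists i => //=.
exact: leq_trans iN _.
Qed.

Lemma finite_prefix X N : finite_set (X @` `I_N.+1).
Proof. exact/finite_image/finite_II. Qed.

Lemma missed_column_late X (g1 g2 : G) N (t : R) :
  ~~ (has (fun z => z.1 == g1) (mkseq X N.+1) && has (fun z => z.1 == g2) (mkseq X N.+1)) ->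
  t <= N.+1%:R -> (t%:E <= disconnection_time X)%E.
Proof.
rewrite negb_and => H tN; apply: (@disconnection_time_ge _ N) => // n nN.
case/orP: H => /hasPn H.
  apply: (@column_not_disconnects _ _ g1) => u /(image_sub nN)/H.
  by rewrite eqxx.
apply: (@column_not_disconnects _ _ g2) => u /(image_sub nN)/H.
by rewrite eqxx.
Qed.

Definition crowded (m : nat) p : bool :=
  has (fun z0 : E => (m < count (fun z : E => z.2 == z0.2) p)%N) p.

Lemma uncrowded_late X (m : nat) N (t : R) :
  ~~ crowded m (mkseq X N.+1) -> t <= N.+1%:R ->
  (maxdeg G * m)%:R < spectral_gap G R * #|G|%:R / 8 -> (2 * m <= #|G|)%N ->
  (t%:E <= disconnection_time X)%E.
Proof.
move=> /hasPn Xm tN gap m2; apply: (@disconnection_time_ge _ N) => // n nN.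
set p := mkseq X N.+1 in Xm.
apply: (@small_levels_not_disconnects G R m _ (fun u => [set g | (g, u) \in p]%SET)) => //.
  by move=> g u /(image_sub nN); rewrite inE.
move=> u; have [[g gp]|none] := pselect (exists g, (g, u) \in p); last first.
  by rewrite (_ : [set _ | _]%SET = finset.set0) ?cards0//; apply/setP => g; rewrite !inE;
    apply/negP => gp; apply: none; exists g.
have := Xm _ gp; rewrite -leqNgt /= => cm; apply: leq_trans cm.
pose s := [seq z.1 | z <- p & z.2 == u].
apply: leq_trans (_ : _ <= size s)%N _; last by rewrite size_map size_filter.
apply: leq_trans (card_size s).
apply: subset_leq_card; apply/fintype.subsetP => g'; rewrite inE => g'p.
by apply/mapP; exists (g', u); rewrite // mem_filter eqxx.
Qed.

Lemma ler_Ex_paths N x (F F' : seq E -> R) :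
  (forall p, p \in paths N x -> F p <= F' p) -> Ex N x F <= Ex N x F'.
Proof.
elim: N x F F' => [|N IH] x F F' FF' /=; first by apply: FF'; rewrite inE.
apply: ler_avg => z zx; apply: IH => p pz; apply: FF'; apply/mem_pathsS.
by exists z, p.
Qed.

Lemma paths_height N x p z : p \in paths N x -> z \in p -> (height x.2 z <= N)%N.
Proof.
elim: N x p => [|N IH] x p.
  by rewrite inE => /eqP->; rewrite inE => /eqP->; rewrite /height subrr.
move=> /mem_pathsS[y [q [yx /IH qy ->]]]; rewrite inE => /orP[/eqP->|/qy].
  by rewrite /height subrr.
move: yx; rewrite mem_nbrs /adjE /height => /orP[/andP[_]|/andP[/eqP ->]]; lia.
Qed.

Lemma crowded_le (N m D : nat) (b : R) x : (maxdeg G <= D)%N -> 0 < b <= 1 ->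
  Ex N x (fun p => (crowded m p)%:R) <=
    (2 * N + 1)%:R * ((1 - b / (2 + D%:R)) ^+ m * (2 * (1 + b ^+ 2) ^+ N)).
Proof.
move=> GD b01.
(* Within [N] steps the walk meets only the [2 * N + 1] levels at distance at most [N] from its
   start. *)
pose lv (i : nat) : int := x.2 - N%:Z + i%:Z.
apply: le_trans (_ : Ex N x (fun p =>
    \sum_(i <- iota 0 (2 * N + 1)) (m < count (fun z => z.2 == lv i) p)%N%:R) <= _).
  apply: ler_Ex_paths => p px; case: (boolP (crowded m p)) => [|_]; last first.
    by apply: sumr_ge0 => i _; rewrite ler0n.
  move=> /hasP[z zp zm]; have := paths_height px zp; rewrite /height => zN.
  have il : absz (z.2 - x.2 + N%:Z)%R \in iota 0 (2 * N + 1).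
    by rewrite mem_iota /=; lia.
  rewrite (big_rem _ il) /=.
  have -> : lv (absz (z.2 - x.2 + N%:Z)%R) = z.2 by rewrite /lv; lia.
  by rewrite zm lerDl; apply: sumr_ge0 => i _; rewrite ler0n.
rewrite Ex_sum; apply: le_trans (_ : \sum_(i <- iota 0 (2 * N + 1))
    ((1 - b / (2 + D%:R)) ^+ m * (2 * (1 + b ^+ 2) ^+ N)) <= _).
  by apply: ler_sum => i _; exact: level_visits.
by rewrite big_const_seq count_predT size_iota iter_addr_0 -[leLHS]mulr_natl.
Qed.

(** The bound on [h] makes the squared oscillation at most 1/4: 192 and 48 are 4 times the constants
    of [potential_oscillation], and the energy contributes [#|G| / h]. *)
Lemma potential_exists (h : nat) (g0 : G) : connected_graph G ->
  (192 * harmonic R #|G| + 48) * #|G|%:R <= h%:R :> R ->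
  exists phi : G -> nat -> R, [/\ admissible h g0 phi,
    forall g j, (j < h)%N -> (g, j) != (g0, 0%N) -> 0 <= lapl phi g j &
    forall g, 2^-1 <= phi g 0%N].
Proof.
move=> Gc hH; have n0 := card_vertex_gt0 G R.
have H0 : 0 <= harmonic R #|G| by apply: sumr_ge0 => i _; rewrite invr_ge0.
have nh : #|G|%:R <= h%:R :> R.
  by apply: le_trans hH; rewrite ler_peMl ?(ltW n0)//; lra.
have h0 : 0 < h%:R :> R by apply: lt_le_trans nh.
rewrite ler_nat in nh; have hn : (0 < h)%N by rewrite -(ltr_nat R).
have [phi adm pmin] := potential_minimizer R g0 hn.
exists phi; split => // [g j|g]; first exact: potential_subharmonic adm pmin.
have [p01 _ pg] := adm.
have := potential_oscillation phi g0 g Gc nh; rewrite pg => osc.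
have en := energy_le hn pmin.
have {osc} : (1 - phi g 0%N) ^+ 2 <= 2^-1 ^+ 2.
  apply: le_trans osc _.
  apply: le_trans (_ : (48 * harmonic R #|G| + 12) * (#|G|%:R / h%:R) <= _).
    by rewrite ler_wpM2l//; lra.
  rewrite mulrA ler_pdivrMr//.
  apply: le_trans (_ : 2^-1 ^+ 2 * ((192 * harmonic R #|G| + 48) * #|G|%:R) <= _).
    by rewrite mulrA ler_wpM2r ?(ltW n0)//; rewrite expr2; lra.
  by rewrite ler_wpM2l// sqr_ge0.
rewrite ler_pXn2r ?nnegrE ?invr_ge0//; first by lra.
by rewrite subr_ge0; case/andP: (p01 g 0%N).
Qed.

(** Either fewer than [k] rounds are completed, or some vertex of the starting level is missed by
    [k] rounds; the last term is the union bound over the level. *)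
Lemma uncovered_le (N h k D : nat) (b : R) x : connected_graph G -> (maxdeg G <= D)%N ->
  0 < b < 1 -> (0 < k)%N -> (192 * harmonic R #|G| + 48) * #|G|%:R <= h%:R :> R ->
  Ex N x (fun p => [exists g, (g, x.2) \notin p]%:R) <=
    (2 * k * h)%:R * b + (1 + N%:R * (b ^+ 2 / (2 + D%:R)))^-1 + #|G|%:R * 2^-1 ^+ k.
Proof.
move=> Gc GD b01 k0 hH; have n0 := card_vertex_gt0 G R.
have h0 : (0 < h)%N.
  rewrite -(ltr_nat R) (lt_le_trans _ hH)// mulr_gt0//.
  have : 0 <= harmonic R #|G| by apply: sumr_ge0 => i _; rewrite invr_ge0.
  by lra.
have x0 : height x.2 x = 0%N by rewrite /height subrr.
apply: le_trans (_ : Ex N x (fun p => (rounds h x.2 p < k)%N%:R +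
    \sum_(g <- enum G) (((g, x.2) \notin p) && (k <= rounds h x.2 p)%N)%:R) <= _).
  apply: ler_Ex => p; case: (boolP [exists g, _]) => [/existsP[g gp]|_]; last first.
    by rewrite addr_ge0 ?ler0n//; apply: sumr_ge0 => g _; rewrite ler0n.
  case: ltnP => kr; first by rewrite lerDl; apply: sumr_ge0 => g' _; rewrite ler0n.
  have ge : g \in enum G by rewrite mem_enum.
  rewrite add0r (big_rem _ ge) /= gp lerDl; apply: sumr_ge0 => g' _; exact: ler0n.
rewrite ExD Ex_sum; apply: lerD; first exact: few_rounds.
apply: le_trans (_ : \sum_(g <- enum G) 2^-1 ^+ k <= _).
  apply: ler_sum => g _; have [phi [adm sub half]] := potential_exists g Gc hH.
  exact: rounds_missing adm sub half x0 k0.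
by rewrite big_const_seq count_predT -cardE iter_addr_0 -[leLHS]mulr_natl.
Qed.

Lemma covered_early X N (u0 : int) (t : R) : connected_graph G ->
  ~~ [exists g, (g, u0) \notin mkseq X N.+1] -> N%:R <= t ->
  (disconnection_time X <= t%:E)%E.
Proof.
move=> Gc Xu Nt; apply: disconnection_time_le Nt.
apply: (@covered_level_disconnects _ _ u0 Gc); first exact: finite_prefix.
move=> g; apply/mem_mkseq_image; apply: contraNT Xu => gX.
by apply/existsP; exists g.
Qed.

End Events.

(** * Asymptotics as the base grows *)

Section Asymptotics.
Variable R : realType.
Implicit Types (n D : nat) (a C d e eta : R).

Lemma near_powR_ge a C : 0 < a -> \forall n \near \oo, C <= n%:R `^ a :> R.
Proof.
move=> a0; pose c := Num.max 1 C.
have c0 : 0 <= c by rewrite le_max ler01.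
exists (Num.truncn (c `^ a^-1)).+1 => // n /= nc.
have cn : c `^ a^-1 <= n%:R.
  apply: le_trans (ltW (_ : _ < (Num.truncn (c `^ a^-1)).+1%:R)) _; last by rewrite ler_nat.
  by have /andP[] := truncn_itv (powR_ge0 c a^-1).
have := @ge0_ler_powR R a (ltW a0) (c `^ a^-1) n%:R; rewrite !nnegrE powR_ge0 ler0n.
move=> /(_ isT isT cn); rewrite -powRrM mulVf ?gt_eqF// powRr1//.
by apply: le_trans; rewrite le_max lexx orbT.
Qed.

Lemma near_ln_ge C : \forall n \near \oo, C <= ln n%:R :> R.
Proof.
exists (Num.truncn (expR C)).+1 => // n /= nC.
have Cn : expR C <= n%:R.
  apply: le_trans (ltW (_ : _ < (Num.truncn (expR C)).+1%:R)) _; last by rewrite ler_nat.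
  by have /andP[] := truncn_itv (expR_ge0 C).
by rewrite -(expRK C) ler_ln ?posrE ?expR_gt0// (lt_le_trans (expR_gt0 C)).
Qed.

Lemma near_powR_ln_ge a C : 0 < a -> \forall n \near \oo, C <= ln n%:R `^ a :> R.
Proof.
move=> a0; pose c := Num.max 1 C.
have c0 : 0 <= c by rewrite le_max ler01.
apply: filterS (near_ln_ge (c `^ a^-1)) => n nc.
have l0 : 0 <= ln n%:R :> R by apply: le_trans nc; exact: powR_ge0.
have := @ge0_ler_powR R a (ltW a0) (c `^ a^-1) (ln n%:R); rewrite !nnegrE powR_ge0 l0.
move=> /(_ isT isT nc); rewrite -powRrM mulVf ?gt_eqF// powRr1//.
by apply: le_trans; rewrite le_max lexx orbT.
Qed.

Lemma ln_le_powR a n : 0 < a -> (0 < n)%N -> ln n%:R <= a^-1 * n%:R `^ a :> R.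
Proof.
move=> a0 n0; have nR : 0 < n%:R :> R by rewrite ltr0n.
have y0 := powR_gt0 a nR.
rewrite ler_pdivlMl// -ln_powR -[X in ln X](addrNK 1) addrC.
apply: le_trans (le_ln1Dx _) _; lra.
Qed.

Lemma harmonic_le n : (0 < n)%N -> harmonic R n <= 1 + ln n%:R.
Proof.
elim: n => [//|[|n] IH] _; first by rewrite /harmonic big_ord1 ln1 addr0 invr1.
rewrite /harmonic big_ord_recr /= -/(harmonic R n.+1).
have {}IH := IH isT.
have n1 : 0 < n.+1%:R :> R by rewrite ltr0n.
have n2 : 0 < n.+2%:R :> R by rewrite ltr0n.
have E : n.+2%:R = n.+1%:R + 1 :> R by rewrite natr1.
suff lnS : ln n.+1%:R <= ln n.+2%:R - n.+2%:R^-1 :> R.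
  by apply: le_trans (lerD IH (lexx _)) _; rewrite -addrA lerD2l -lerBrDr.
have -> : n.+1%:R = n.+2%:R * (1 + - n.+2%:R^-1) :> R.
  by rewrite mulrDr mulr1 mulrN mulfV ?gt_eqF// E addrK.
have i1 : n.+2%:R^-1 < 1 :> R by rewrite invf_lt1// E ltrDr.
rewrite lnM ?posrE//; last by rewrite subr_gt0.
by rewrite lerD2l; apply: le_ln1Dx; rewrite ltrN2.
Qed.

(** With l = ln n, the product k h is of order n l^2, so that [few_rounds] asks for a time of order
    n^2 l^4; the remaining l^e outgrows the constant [K]. Each of the three terms of [uncovered_le]
    receives eta / 3. *)
Lemma upper_tail D e eta : 0 < e -> 0 < eta <= 1 ->
  \forall n \near \oo, forall (G : sgraph) (x : cylinder G),
    connected_graph G -> (maxdeg G <= D)%N -> #|G| = n ->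
    Ex (Num.truncn (n%:R ^+ 2 * ln n%:R `^ (4 + e))) x
      (fun p => [exists g, (g, x.2) \notin p]%:R) <= eta :> R.
Proof.
move=> e0 /andP[eta0 eta1].
have [C1 C1_ge1 C1P] : exists2 C1 : R, 1 <= C1 &
    forall l H : R, 1 <= l -> H <= 1 + l -> 192 * H + 48 <= C1 * l.
  by exists (192 + 192 + 48) => [|l H]; lra.
pose C2 := 5 * (C1 + 1).
have C2_ge0 : 0 <= C2 by rewrite /C2; lra.
(* Calibrated so that [N%:R * (b ^+ 2 / (2 + D%:R))] is at least 3 / eta. *)
pose K : R := 3 * (2 + D%:R) * (6 * C2) ^+ 2 / eta ^+ 3.
near=> n => G x Gc GD Gn.
have n0 : (0 < n)%N by near: n; exact: nbhs_infty_gt.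
have nR : 0 < n%:R :> R by rewrite ltr0n.
have n1 : 1 <= n%:R :> R by rewrite ler1n.
have l1 : 1 <= ln n%:R :> R by near: n; exact: near_ln_ge.
(* The additional 1 pays for the truncation of the time to an integer. *)
have le : K + 1 <= ln n%:R `^ e by near: n; exact: near_powR_ln_ge.
have neta : 3 / eta <= n%:R.
  near: n; apply: filterS (near_powR_ge (3 / eta) (@ltr01 R)) => n.
  by rewrite powRr1.
set l : R := ln n%:R in l1 le *.
have l0 : 0 < l by apply: lt_le_trans l1.
set T := n%:R ^+ 2 * l `^ (4 + e); set N := Num.truncn T.
have T0 : 0 <= T by rewrite mulr_ge0 ?exprn_ge0 ?powR_ge0// ltW.
have D0 : 0 < 2 + D%:R :> R by rewrite ltr_pwDl ?ler0n.
have ln1 : 1 <= l * n%:R by rewrite -[leLHS]mulr1 ler_pM.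
pose h := (Num.truncn (C1 * (l * n%:R))).+1.
(* As k >= 4 l, 2^-k <= exp(- k / 2) <= n^-2, which leaves 1 / n after the union bound over the
   level. *)
pose k := (Num.truncn (4 * l)).+1.
have /andP[k1 k2] := truncn_itv (mulr_ge0 (ler0n R 4) (ltW l0)).
have kl : k%:R <= 5 * l by rewrite /k -natr1; lra.
have h0' : 0 <= C1 * (l * n%:R) by rewrite mulr_ge0// (le_trans ler01).
have /andP[h1 h2] := truncn_itv h0'.
have hl : h%:R <= (C1 + 1) * (l * n%:R) by rewrite /h -natr1 mulrDl mul1r lerD.
have hH : (192 * harmonic R #|G| + 48) * #|G|%:R <= h%:R :> R.
  apply: le_trans (ltW h2); rewrite Gn mulrA ler_wpM2r ?(ltW nR)//.
  exact: C1P (harmonic_le n0).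
have k0 : 0 < k%:R :> R by rewrite ltr0n.
have h0 : 0 < h%:R :> R by rewrite ltr0n.
have kN : (0 < k)%N by [].
have hN : (0 < h)%N by [].

have k2' : 4 * l <= k%:R by exact: ltW.
have /andP[_ TN] := truncn_itv T0; rewrite -/N -natr1 in TN.
clearbody h k N; clear k1 k2 h1 h2.
have kh0 : 0 < k%:R * h%:R :> R by rewrite !mulr_gt0.
have kh1 : 1 <= k%:R * h%:R :> R by rewrite -natrM ler1n muln_gt0 kN hN.
(* Makes the first term [(2 * k * h)%:R * b] equal to eta / 3. *)
pose b := eta / (6 * (k%:R * h%:R)).
have kh60 : 0 < 6 * (k%:R * h%:R) :> R by rewrite !mulr_gt0.
have b01 : 0 < b < 1.
  by rewrite /b divr_gt0//= ltr_pdivrMr// mul1r; lra.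
apply: le_trans (uncovered_le N x Gc GD b01 kN hH) _.
have -> : eta = eta / 3 + eta / 3 + eta / 3 by field.
apply: lerD; first apply: lerD.
- rewrite !natrM le_eqVlt; apply/orP; left; apply/eqP; rewrite /b.
  by field; rewrite !gt_eqF.
- have B0 : 0 < b ^+ 2 / (2 + D%:R).
    by case/andP: b01 => b0 _; rewrite divr_gt0// exprn_gt0.
  suff NB : 3 / eta <= N%:R * (b ^+ 2 / (2 + D%:R)).
    have -> : eta / 3 = (3 / eta)^-1 by rewrite invf_div.
    have e30 : 0 < 3 / eta by rewrite divr_gt0.
    by rewrite lef_pV2 ?posrE//; lra.
  have kh : k%:R * h%:R <= C2 * (n%:R * l ^+ 2).
    apply: le_trans (ler_pM (ltW k0) (ltW h0) kl hl) _.
    by rewrite /C2 le_eqVlt; apply/orP; left; apply/eqP; ring.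
  have kh2 : (k%:R * h%:R) ^+ 2 <= C2 ^+ 2 * (n%:R ^+ 2 * l ^+ 4) :> R.
    have -> : C2 ^+ 2 * (n%:R ^+ 2 * l ^+ 4) = (C2 * (n%:R * l ^+ 2)) ^+ 2 by ring.
    by rewrite ler_pXn2r ?nnegrE// ?(ltW kh0)// (le_trans (ltW kh0)).
  have NT : n%:R ^+ 2 * l ^+ 4 * K <= N%:R.
    have TE : T = n%:R ^+ 2 * l ^+ 4 * l `^ e.
      rewrite /T powRD; last by rewrite (gt_eqF l0) implybT.
      by rewrite (powR_mulrn 4 (ltW l0)) mulrA.
    have nl : 1 <= n%:R ^+ 2 * l ^+ 4 by rewrite -[leLHS]mulr1 ler_pM ?exprn_ege1.
    have : n%:R ^+ 2 * l ^+ 4 * (K + 1) <= T by rewrite TE ler_wpM2l// (le_trans ler01).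
    by rewrite mulrDr mulr1; lra.
  have bE : b ^+ 2 = eta ^+ 2 / (6 ^+ 2 * (k%:R * h%:R) ^+ 2).
    by rewrite /b; field; rewrite !gt_eqF.
  set P : R := (k%:R * h%:R) ^+ 2 in kh2 bE *.
  have P0 : 0 < P by rewrite exprn_gt0.
  have NP : P * (3 * (2 + D%:R) * 6 ^+ 2 / eta ^+ 3) <= N%:R.
    apply: le_trans NT; apply: le_trans (ler_wpM2r _ kh2) _.
      by rewrite divr_ge0 ?exprn_ge0 ?(ltW eta0)// !mulr_ge0 ?exprn_ge0// ltW.
    by rewrite /K le_eqVlt; apply/orP; left; apply/eqP; field; rewrite gt_eqF.
  apply: le_trans (_ : P * (3 * (2 + D%:R) * 6 ^+ 2 / eta ^+ 3) * (b ^+ 2 / (2 + D%:R)) <= _).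
    by rewrite bE le_eqVlt; apply/orP; left; apply/eqP; field; rewrite !gt_eqF.
  by rewrite ler_wpM2r// ltW.
- rewrite Gn; have k3 : 2^-1 ^+ k <= expR (- (2 * l)).
    have h2' : 2^-1 <= expR (- 2^-1) :> R.
      by apply: le_trans (expR_ge1Dx _); lra.
    apply: le_trans (_ : expR (- 2^-1) ^+ k <= _).
      by rewrite lerXn2r ?nnegrE ?invr_ge0 ?expR_ge0.
    rewrite -expRM_natl ler_expR; lra.
  have nE : n%:R * expR (- (2 * l)) = n%:R^-1.
    have -> : 2 * l = l + l by ring.
    by rewrite expRN expRD /l !lnK ?posrE// invfM mulrA mulfV ?mul1r// gt_eqF.
  apply: le_trans (_ : n%:R * expR (- (2 * l)) <= _); first by rewrite ler_wpM2l// ltW.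
  have -> : eta / 3 = (3 / eta)^-1 by rewrite invf_div.
  by rewrite nE lef_pV2 ?posrE// divr_gt0.
Unshelve. all: by end_near.
Qed.

(** The time n^(2 (1 - d)) cancels the power of n in the gap, and the factor 1 / ln n of the class
    is what makes the bound of [column_missed] vanish. *)
Lemma small_gap_tail d eta : 0 < d < 2^-1 -> 0 < eta ->
  \forall n \near \oo, forall G : sgraph,
    (2 <= #|G|)%N -> #|G| = n ->
    spectral_gap G R <= n%:R `^ (- (2 * (1 - d))) * (ln n%:R)^-1 ->
    exists N (Q : pred (seq (cylinder G))),
      (forall X, ~~ Q (mkseq X N.+1) ->
         ((n%:R `^ (2 * (1 - d)))%:E <= disconnection_time X :> \bar R)%E) /\
      forall x, Ex N x (fun p => (Q p)%:R) <= eta :> R.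
Proof.
move=> /andP[d0 d1] eta0; near=> n => G G2 Gn gap.
have n0 : (0 < n)%N by near: n; exact: nbhs_infty_gt.
have nR : 0 < n%:R :> R by rewrite ltr0n.
have l1 : Num.max 1 eta^-1 <= ln n%:R :> R by near: n; exact: near_ln_ge.
move: l1; rewrite ge_max => /andP[l1 l2].
have l0 : 0 < ln n%:R :> R by apply: lt_le_trans l1.
move: gap; set t := n%:R `^ (2 * (1 - d)); rewrite powRN -/t => gap.
have t0 : 0 < t by exact: powR_gt0.
have /andP[N1 N2] := truncn_itv (ltW t0); set N := Num.truncn t in N1 N2.
have [g1 [g2 g12]] := column_missed R G2.
exists N, (fun p => has (fun z => z.1 == g1) p && has (fun z => z.1 == g2) p); split.
  by move=> X XQ; apply: missed_column_late XQ (ltW N2).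
move=> x; apply: le_trans (g12 N x) _.
apply: le_trans (_ : N%:R * (t^-1 * (ln n%:R)^-1) <= _); first by rewrite ler_wpM2l.
apply: le_trans (_ : t * (t^-1 * (ln n%:R)^-1) <= _).
  by rewrite ler_wpM2r// mulr_ge0// invr_ge0 ltW.
by rewrite mulVKf ?gt_eqF// -(invrK eta) lef_pV2 ?posrE// invr_gt0.
Unshelve. all: by end_near.
Qed.

(** With m of order n^(1 - d/2) visits per level and b = n^(- (1 - d)), N b^2 is at most 1 while m b
    is of order n^(d/2): the probability of a crowded level is at most of order n^2 exp(- c
    n^(d/2)). *)
Lemma large_gap_tail D d eta : 0 < d < 2^-1 -> 0 < eta ->
  \forall n \near \oo, forall G : sgraph,
    (maxdeg G <= D)%N -> #|G| = n ->
    n%:R `^ (- (d / 10)) <= spectral_gap G R ->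
    exists N (Q : pred (seq (cylinder G))),
      (forall X, ~~ Q (mkseq X N.+1) ->
         ((n%:R `^ (2 * (1 - d)))%:E <= disconnection_time X :> \bar R)%E) /\
      forall x, Ex N x (fun p => (Q p)%:R) <= eta :> R.
Proof.
move=> /andP[d0 d1] eta0.
have D0 : 0 < 2 + D%:R :> R by rewrite ltr_pwDl ?ler0n.
(* For y = n^(d/2) this gives y^K >= n^3, so exp(c y) >= (c y / K)^K beats the factor n^2 of the
   union bound by one power of n. *)
pose K := (Num.truncn (6 / d)).+1.
have K0 : 0 < K%:R :> R by rewrite ltr0n.
have Kd : 3 <= K%:R * (d / 2).
  have /andP[_ K2] := truncn_itv (ltW (divr_gt0 (ltr0n R 6) d0)).
  by move: K2; rewrite -/K ltr_pdivrMr//; lra.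
clearbody K.
pose c : R := (2 * (2 + D%:R))^-1.
have c0 : 0 < c by rewrite invr_gt0 mulr_gt0.
pose M : R := 6 * expR 1 / (eta * (c / K%:R) ^+ K).
near=> n => G GD Gn gap.
have n0 : (0 < n)%N by near: n; exact: nbhs_infty_gt.
have nR : 0 < n%:R :> R by rewrite ltr0n.
have n1 : 1 <= n%:R :> R by rewrite ler1n.
have Mn : M <= n%:R.
  by near: n; apply: filterS (near_powR_ge M (@ltr01 R)) => n; rewrite powRr1.
have y2 : 2 <= n%:R `^ (d / 2) by near: n; apply: near_powR_ge; lra.
(* The exponent is the margin between 1 - d/10 from the isoperimetric inequality and 1 - d/2 from
   the visits. *)
have y8 : 8 * D%:R + 1 <= n%:R `^ (2 / 5 * d) by near: n; apply: near_powR_ge; lra.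
pose y : R := n%:R `^ (d / 2); rewrite -/y in y2.
pose t : R := n%:R `^ (2 * (1 - d)); rewrite -/t.
have nn u v : n%:R `^ (u + v) = n%:R `^ u * n%:R `^ v :> R.
  by rewrite powRD// (gt_eqF nR) implybT.
have p0 u : 0 < n%:R `^ u :> R by exact: powR_gt0.
have /andP[N1 N2] := truncn_itv (ltW (p0 (2 * (1 - d)))); set N := Num.truncn _ in N1 N2.
have /andP[m1 m2] := truncn_itv (ltW (p0 (1 - d / 2))); set m := Num.truncn _ in m1 m2.
have {}m2 : n%:R `^ (1 - d / 2) < m%:R + 1 by rewrite natr1.
clearbody N m.
pose b : R := n%:R `^ (- (1 - d)).
have b01 : 0 < b <= 1.
  by rewrite p0 /= -[leRHS](powRr0 n%:R) ler_powR//; lra.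
have [b0 b1] := andP b01.
have nE : n%:R = n%:R `^ (1 - d / 2) * y :> R.
  by rewrite /y -nn -[LHS]powRr1 ?(ltW nR)//; congr (_ `^ _); ring.
have z0 := p0 (1 - d / 2).
exists N, (@crowded G m); split.
  move=> X XQ; apply: uncrowded_late XQ (ltW N2) _ _.
    apply: le_lt_trans (_ : D%:R * n%:R `^ (1 - d / 2) < _).
      by rewrite natrM ler_pM ?ler0n ?ler_nat.
    apply: lt_le_trans (_ : n%:R `^ (- (d / 10)) * n%:R / 8 <= _); last first.
      by rewrite Gn ler_wpM2r// ler_wpM2r ?(ltW nR).
    have -> : n%:R `^ (- (d / 10)) * n%:R = n%:R `^ (1 - d / 2) * n%:R `^ (2 / 5 * d).
      rewrite -[X in _ * X = _]powRr1 ?(ltW nR)// -!nn; congr (_ `^ _).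
      by field.
    by rewrite -mulrA (mulrC D%:R) ltr_pM2l//; lra.
  rewrite Gn -(ler_nat R) natrM nE mulrC.
  by rewrite ler_pM ?ler0n//; lra.
move=> x; apply: le_trans (crowded_le N m x GD b01) _.
have e1 : (1 + b ^+ 2) ^+ N <= expR 1.
  apply: le_trans (_ : expR (b ^+ 2) ^+ N <= _).
    rewrite lerXn2r ?nnegrE ?expR_ge0 ?expR_ge1Dx// addr_ge0// sqr_ge0//.
  rewrite -expRM_natl ler_expR.
  apply: le_trans (_ : t * b ^+ 2 <= _); first by rewrite ler_wpM2r ?sqr_ge0.
  rewrite expr2 /t /b -!nn le_eqVlt; apply/orP; left; apply/eqP.
  by rewrite -[RHS](powRr0 n%:R); congr (_ `^ _); ring.
have bD : 0 <= 1 - b / (2 + D%:R).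
  by rewrite subr_ge0 ler_pdivrMr//; have := ler0n R D; lra.
have e2 : (1 - b / (2 + D%:R)) ^+ m <= expR (- (c * y)).
  apply: le_trans (_ : expR (- (b / (2 + D%:R))) ^+ m <= _).
    by rewrite lerXn2r ?nnegrE ?expR_ge0 ?expR_ge1Dx.
  rewrite -expRM_natl ler_expR mulrN lerN2.
  have mb : y / 2 <= m%:R * b.
    apply: le_trans (_ : (n%:R `^ (1 - d / 2) - 1) * b <= _); last first.
      by rewrite ler_wpM2r ?(ltW b0)// lerBlDr ltW.
    rewrite mulrBl mul1r.
    have -> : n%:R `^ (1 - d / 2) * b = y.
      by rewrite /b /y -nn; congr (_ `^ _); field.
    lra.
  have -> : c * y = y / 2 / (2 + D%:R) by rewrite /c; field; rewrite gt_eqF.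
  by rewrite mulrA ler_wpM2r// invr_ge0 ltW.
have N3 : (2 * N + 1)%:R <= 3 * n%:R ^+ 2 :> R.
  have tn : t <= n%:R ^+ 2.
    by rewrite -(powR_mulrn 2 (ltW nR)) ler_powR//; lra.
  have n21 : 1 <= n%:R ^+ 2 :> R by rewrite exprn_ege1.
  by rewrite natrD natrM; move: N1; rewrite -/t; lra.
have ey : (c / K%:R) ^+ K * n%:R ^+ 3 <= expR (c * y).
  have cy0 : 0 <= c * y by rewrite mulr_ge0 ?(ltW c0)// (le_trans _ y2).
  have -> : c * y = K%:R * (c * y / K%:R) by rewrite mulrCA mulfV ?mulr1// gt_eqF.
  rewrite expRM_natl.
  apply: le_trans (_ : (c * y / K%:R) ^+ K <= _); last first.
    rewrite lerXn2r ?nnegrE ?expR_ge0 ?divr_ge0 ?ler0n//.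
    by apply: le_trans (expR_ge1Dx _); lra.
  have -> : (c * y / K%:R) ^+ K = (c / K%:R) ^+ K * y ^+ K by rewrite -exprMn mulrAC.
  rewrite ler_wpM2l ?exprn_ge0 ?divr_ge0 ?(ltW c0) ?ler0n//.
  rewrite -(powR_mulrn 3 (ltW nR)) -powR_mulrn ?(ltW (p0 _))// /y -powRrM.
  by rewrite ler_powR// mulrC.
have cK0 : 0 < (c / K%:R) ^+ K by rewrite exprn_gt0// divr_gt0.
apply: le_trans (_ : 3 * n%:R ^+ 2 * (expR (- (c * y)) * (2 * expR 1)) <= _).
  have X0 : 0 <= (1 - b / (2 + D%:R)) ^+ m by rewrite exprn_ge0.
  have Y0 : 0 <= 2 * (1 + b ^+ 2) ^+ N.
    by rewrite mulr_ge0// exprn_ge0// addr_ge0 ?sqr_ge0.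
  apply: ler_pM => //; first by rewrite mulr_ge0.
  by apply: ler_pM => //; rewrite ler_pM2l.
rewrite expRN; have E0 := expR_gt0 (c * y).
have -> : 3 * n%:R ^+ 2 * ((expR (c * y))^-1 * (2 * expR 1)) =
   6 * expR 1 * n%:R ^+ 2 / expR (c * y) by field; rewrite gt_eqF.
rewrite ler_pdivrMr//; apply: le_trans (_ : eta * ((c / K%:R) ^+ K * n%:R ^+ 3) <= _); last first.
  by rewrite ler_wpM2l// ltW.
move: Mn; rewrite /M ler_pdivrMr ?mulr_gt0// => Mn.
apply: le_trans (ler_wpM2r (sqr_ge0 _) Mn) _.
by rewrite le_eqVlt; apply/orP; left; apply/eqP; ring.
Unshelve. all: by end_near.
Qed.

End Asymptotics.

(** * Conclusion *)

Section Assembly.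
Variable R : realType.
Implicit Types (G : sgraph) (d e eta : R).

Definition disconnection_event G d e : set (trajectory G) :=
  [set X | ((#|G|%:R `^ (2 * (1 - d)))%:E <= disconnection_time X
     <= (#|G|%:R ^+ 2 * ln #|G|%:R `^ (4 + e))%:E)%E].
Arguments disconnection_event : clear implicits.

Lemma upper_time_ge0 G e : 0 <= #|G|%:R ^+ 2 * ln #|G|%:R `^ (4 + e) :> R.
Proof. by apply: mulr_ge0; [exact: sqr_ge0|exact: powR_ge0]. Qed.

Lemma measurable_event G d e : measurable (disconnection_event G d e).
Proof. exact: (measurable_disconnection_event _ (upper_time_ge0 G e)). Qed.

Lemma near_event_prob (d0 : nat) d e eta : 0 < d < 2^-1 -> 0 < e -> 0 < eta <= 1 ->
  \forall n \near \oo, forall G, G_ext d0 d G -> #|G| = n -> forall x : cylinder G,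
    ((1 - (eta + eta))%:E <= srw_law R x (disconnection_event G d e))%E.
Proof.
move=> d12 e0 eta01; have /andP[eta0 _] := eta01.
apply: filterS3 (upper_tail d0 e0 eta01) (small_gap_tail d12 eta0)
  (large_gap_tail d0 d12 eta0) => n up lo1 lo2 G [Gc G2 Gd gap] Gn x.
rewrite /disconnection_event; rewrite Gn in gap *.
have [N [Q [XQ QE]]] : exists N (Q : pred (seq (cylinder G))),
      (forall X, ~~ Q (mkseq X N.+1) ->
         ((n%:R `^ (2 * (1 - d)))%:E <= disconnection_time X :> \bar R)%E) /\
      forall x, Ex N x (fun p => (Q p)%:R) <= eta :> R.
  by case: gap => gap; [exact: lo1|exact: lo2].
pose Q2 : pred (seq (cylinder G)) := fun p => [exists g, (g, x.2) \notin p].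
apply: (@disconnection_prob_ge _ _ _ _ _ _ _ _ _ _ Q2 _ XQ _ (QE x) (up G x Gc Gd Gn)).
- by rewrite -Gn; exact: upper_time_ge0.
- move=> X XU; apply: covered_early Gc XU _.
  have t0 : 0 <= n%:R ^+ 2 * ln n%:R `^ (4 + e) :> R by rewrite -Gn; exact: upper_time_ge0.
  by have /andP[] := truncn_itv t0.
Qed.

Lemma inf_disconnection_prob_le1 d e G : (inf_disconnection_prob d e G <= 1)%E.
Proof.
apply: (@le_trans _ _ (srw_law R (point : cylinder G) (disconnection_event G d e))).
  by apply: ereal_inf_lbound; exists point.
by apply: probability_le1; exact: measurable_event.
Qed.

Lemma nbhs_one_ereal (A : set (\bar R)) : nbhs 1%E A ->
  exists2 eta, 0 < eta <= 1 & forall y : \bar R, ((1 - (eta + eta))%:E <= y <= 1)%E -> A y.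
Proof.
move=> nA; have /nbhs_ballP[r /= r0 rA] : nbhs (1 : R) (fun s : R => A s%:E) by exact: nA.
(* Two tails of at most r / 3 stay within the open ball of radius r; the cap at 1 meets the
   hypothesis of [upper_tail]. *)
exists (Num.min 1 (r / 3)).
  by rewrite lt_min ltr01 divr_gt0//= ge_min lexx.
have m3 : Num.min 1 (r / 3) <= r / 3 by rewrite ge_min lexx orbT.
case=> [s|/andP[_]|/andP[]] //; rewrite !lee_fin => /andP[s1 s2].
by apply: rA; rewrite /ball /= ger0_norm ?subr_ge0//; lra.
Qed.

Lemma event_delta_subset G d d' e : (1 <= #|G|)%N -> d' <= d ->
  disconnection_event G d' e `<=` disconnection_event G d e.
Proof.
move=> G1 dd X /andP[lX Xu]; apply/andP; split => //; apply: le_trans lX.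
by rewrite lee_fin ler_powR ?ler1n//; lra.
Qed.

Lemma inf_prob_ge d d' e eta G : (1 <= #|G|)%N -> d' <= d ->
  (forall x : cylinder G,
    ((1 - (eta + eta))%:E <= srw_law R x (disconnection_event G d' e))%E) ->
  ((1 - (eta + eta))%:E <= inf_disconnection_prob d e G)%E.
Proof.
move=> G1 dd H; apply: le_ereal_inf_tmp => _ [x _ <-]; apply: le_trans (H x) _.
apply: le_measure; rewrite ?inE; [exact: measurable_event..|].
exact: event_delta_subset.
Qed.

Lemma near_ln_le_powR d : 0 < d -> \forall n \near \oo, ln n%:R <= n%:R `^ d :> R.
Proof.
move=> d0; have d2 : 0 < d / 2 by rewrite divr_gt0.
near=> n; have n0 : (0 < n)%N by near: n; exact: nbhs_infty_gt.
apply: le_trans (ln_le_powR d2 n0) _.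
have E : n%:R `^ d = n%:R `^ (d / 2) * n%:R `^ (d / 2) :> R.
  rewrite -powRD; last by rewrite pnatr_eq0 -lt0n n0 implybT.
  by congr (_ `^ _); field.
rewrite E ler_wpM2r ?powR_ge0//.
by near: n; exact: near_powR_ge.
Unshelve. all: by end_near.
Qed.

End Assembly.

Theorem mainTheorem5 (R : realType) (d0 : nat) (hd0 : (2 <= d0)%N) :
  (forall delta eps : R, 0 < delta < 2^-1 -> 0 < eps ->
     cvg_large (G_ext d0 delta) (inf_disconnection_prob delta eps) 1%E)
  /\
  (forall G : nat -> sgraph,
     (forall N, connected_graph (G N)) ->
     (forall N, (maxdeg (G N) <= d0)%N) ->
     #|G N| @[N --> \oo] --> \oo ->
     ((exists theta : nat -> R, theta @ \oo --> (0 : R) /\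
         \forall N \near \oo,
           spectral_gap (G N) R = #|G N|%:R `^ theta N) \/
      (exists theta : nat -> R, theta @ \oo --> (0 : R) /\
         \forall N \near \oo,
           spectral_gap (G N) R = #|G N|%:R `^ (- 2 + theta N))) ->
     forall delta eps : R, 0 < delta -> 0 < eps ->
       inf_disconnection_prob delta eps (G N) @[N --> \oo] --> 1%E).
Proof.
split=> [d e d12 e0 A /nbhs_one_ereal[eta eta01 etaA]|G Gc Gd Goo Ggap d e dgt0 e0].
  have [n0 _ n0P] := near_event_prob d0 d12 e0 eta01.
  exists n0 => G GE Gn; apply: etaA; rewrite inf_disconnection_prob_le1 andbT.
  have [_ G2 _ _] := GE; apply: (inf_prob_ge (ltnW G2) (lexx d)).
  exact: (n0P _ Gn G GE erefl).
(* The first part requires delta below 1/2; as a smaller delta only shrinks the event, larger values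
   follow. *)
pose d' := Num.min d 4^-1.
have d'0 : 0 < d' by rewrite lt_min dgt0 invr_gt0/=.
have d'd : d' <= d by rewrite ge_min lexx.
have d'12 : 0 < d' < 2^-1.
  have : d' <= 4^-1 by rewrite ge_min lexx orbT.
  by rewrite d'0 /=; lra.
have near_card (P : nat -> Prop) : (\forall n \near \oo, P n) -> \forall N \near \oo, P #|G N|.
  by move=> nP; exact: (Goo _ nP).
have G2 := near_card (fun n => (2 <= n)%N) (nbhs_infty_ge 2).
have lnG := near_card _ (near_ln_le_powR d'0).
have ln1 := near_card _ (near_ln_ge (1 : R)).
have Gext : \forall N \near \oo, G_ext d0 d' (G N).
  case: Ggap => -[theta [theta0 gapE]].
    near=> N; split => //; first by near: N.
    right; rewrite (near gapE N)//.
    have G1 : 1 <= #|G N|%:R :> R by rewrite ler1n vertex_gt0.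
    apply: ler_powR => //; near: N.
    by apply: (cvgr_ge _ theta0); rewrite oppr_lt0 divr_gt0.
  near=> N; split => //; first by near: N.
  left; rewrite (near gapE N)//.
  have G1 : 1 <= #|G N|%:R :> R by rewrite ler1n vertex_gt0.
  have G0 : 0 < #|G N|%:R :> R by rewrite ltr0n vertex_gt0.
  have thetaN : theta N <= d' by near: N; exact: (cvgr_le _ theta0).
  have lnN : ln #|G N|%:R <= #|G N|%:R `^ d' :> R.
    by near: N.
  have ln0 : 0 < ln #|G N|%:R :> R.
    by apply: lt_le_trans ltr01 _; near: N.
  rewrite ler_pdivlMr//.
  (* One [d'] bounds theta and the other the logarithm: - 2 + d' + d' = - (2 (1 - d')). *)
  apply: le_trans (_ : #|G N|%:R `^ (- 2 + d') * #|G N|%:R `^ d' <= _).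
    by apply: ler_pM; rewrite ?powR_ge0 ?(ltW ln0)// ler_powR// lerD2l.
  rewrite -powRD; last by rewrite (gt_eqF G0) implybT.
  by apply: ler_powR => //; lra.
move=> A /nbhs_one_ereal[eta eta01 etaA].
have ev := near_card _ (near_event_prob d0 d'12 e0 eta01).
suff : \forall N \near \oo, A (inf_disconnection_prob d e (G N)) by [].
apply: filterS2 Gext ev => N GN evN.
apply: etaA; apply/andP; split; last exact: inf_disconnection_prob_le1.
exact: (inf_prob_ge (vertex_gt0 (G N)) d'd (evN _ GN erefl)).
Unshelve. all: by end_near.
Qed.
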